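(* Let $n\in\mathbb{N}$, $\lambda\in(0,\frac{2\pi}{n})$ and suppose $F\in\pi_{n}(\overline{\mathbb{D}})$. Then $$F\in\overline{\mathcal{D}}_{n}(\lambda)\setminus\overline{\mathcal{T}}_{n}(\lambda)\quad\text{if, and only if,}\quad F+\zeta F^{*n}\in\overline{\mathcal{T}}_{n}(\lambda)\ \text{ for all }\zeta\in\mathbb{T},$$ and $$F\in\mathcal{D}_{n}(\lambda)\setminus\mathcal{T}_{n}(\lambda)\quad\text{if, and only if,}\quad F+\zeta F^{*n}\in\mathcal{T}_{n}(\lambda)\ \text{ for all }\zeta\in\mathbb{T}.$$ Moreover, if $F\in\overline{\mathcal{D}}_{n}(\lambda)\setminus\overline{\mathcal{T}}_{n}(\lambda)$ and if there is a $z_{0}\in\mathbb{T}$ such that $$e^{-in\lambda/2}\frac{F_{+}(z_{0})}{F_{-}(z_{0})}=x\in\mathbb{R},$$ then $$\lim_{z\to z_{0}}e^{-in\lambda/2}\frac{(F+\zeta F^{*n})_{+}(z)}{(F+\zeta F^{*n})_{-}(z)}=x\quad\text{for all }\zeta\in\mathbb{T}.$$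
   Context: All polynomials have complex coefficients. $\mathbb{D}$ is the open unit disk, $\overline{\mathbb{D}}$ its closure, $\mathbb{T}$ the unit circle. For $\Omega\subseteq\mathbb{C}$, $\pi_{n}(\Omega)$ is the set of polynomials of degree $n$ all of whose zeros lie in $\Omega$. $\overline{\mathcal{T}}_{n}(\lambda)$ (resp. $\mathcal{T}_{n}(\lambda)$) is the set of polynomials of degree $n$ all of whose zeros lie on $\mathbb{T}$ and such that each pair of zeros (counted with multiplicity) is separated by an angle of at least $\lambda$ (resp. $>\lambda$). For a polynomial $F$ write $F_{+}(z)=F(e^{i\lambda/2}z)$, $F_{-}(z)=F(e^{-i\lambda/2}z)$. $\overline{\mathcal{D}}_{n}(\lambda)$ is the set of polynomials $F$ of degree $n$ with $$\operatorname{Im}\Bigl(e^{-in\lambda/2}\frac{F_{+}(z)}{F_{-}(z)}\Bigr)>0\quad\text{for all } z\in\mathbb{C}\setminus\overline{\mathbb{D}},$$ and $\mathcal{D}_{n}(\lambda)$ is the union of $\mathcal{T}_{n}(\lambda)$ with the set of all polynomials $F$ of degree $n$ for which the same inequality holds for all $z\in\mathbb{C}\setminus\mathbb{D}$. For a polynomial $F$ of degree $\le n$ its $n$-inverse is $F^{*n}(z)=z^{n}\overline{F(1/\overline{z})}$. *)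

(* Defs.v *)
From HB Require Import structures.
From mathcomp Require Import all_boot all_order all_algebra complex.
From mathcomp Require Import boolp classical_sets reals topology normedtype.
From mathcomp Require Import trigo.

Set Implicit Arguments.
Unset Strict Implicit.
Unset Printing Implicit Defensive.

Import Order.TTheory GRing.Theory Num.Theory numFieldNormedType.Exports.
Local Open Scope classical_set_scope.
Local Open Scope ring_scope.
Local Open Scope complex_scope.

Definition expi (R : realType) (t : R) : R[i] := cos t +i* sin t.

(* Only meant for [z] and [w] on the unit circle: the angle in [0, pi]
   between them, i.e. the length of the shorter arc (see [angle_expi]). *)
Definition angle (R : realType) (z w : R[i]) : R :=
  acos (complex.Re (z * w^*)).

Definition polys_in (R : realType) (n : nat) (Omega : set R[i]) :
    set {poly R[i]} :=
  [set F : {poly R[i]} | size F = n.+1 /\ forall z, root F z -> Omega z].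

Definition closed_disk (R : realType) : set R[i] := [set z : R[i] | `|z| <= 1].
Definition unit_circle (R : realType) : set R[i] := [set z : R[i] | `|z| = 1].

(* [s] lists the zeros of [F] with multiplicity. *)
Definition zeros_of (R : realType) (F : {poly R[i]}) (s : seq R[i]) : Prop :=
  F = lead_coef F *: \prod_(a <- s) ('X - a%:P).

Definition Tclosed (R : realType) (n : nat) (lam : R) : set {poly R[i]} :=
  [set F : {poly R[i]} | polys_in n (@unit_circle R) F /\
     exists2 s, zeros_of F s & pairwise (fun a b => lam <= angle a b) s].

Definition Topen (R : realType) (n : nat) (lam : R) : set {poly R[i]} :=
  [set F : {poly R[i]} | polys_in n (@unit_circle R) F /\
     exists2 s, zeros_of F s & pairwise (fun a b => lam < angle a b) s].

Definition Fplus (R : realType) (lam : R) (F : {poly R[i]}) : {poly R[i]} :=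
  F \Po (expi (lam / 2) *: 'X).

Definition Fminus (R : realType) (lam : R) (F : {poly R[i]}) : {poly R[i]} :=
  F \Po (expi (- (lam / 2)) *: 'X).

(* Takes the value 0 where the denominator vanishes, so that a condition
   [0 < complex.Im (quot n lam F z)] forces [(Fminus lam F).[z] != 0]. *)
Definition quot (R : realType) (n : nat) (lam : R) (F : {poly R[i]})
    (z : R[i]) : R[i] :=
  expi (- (n%:R * lam / 2)) * ((Fplus lam F).[z] / (Fminus lam F).[z]).

Definition Dclosed (R : realType) (n : nat) (lam : R) : set {poly R[i]} :=
  [set F : {poly R[i]} | size F = n.+1 /\
     forall z, ~ closed_disk z -> 0 < complex.Im (quot n lam F z)].

Definition Dopen (R : realType) (n : nat) (lam : R) : set {poly R[i]} :=
  Topen n lam `|`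
  [set F : {poly R[i]} | size F = n.+1 /\
     forall z, ~ `|z| < 1 -> 0 < complex.Im (quot n lam F z)].

(* The [n]-inverse, as a polynomial; [horner_ninv] below recovers the formula
   z ^ n * conj (F (1 / conj z)). *)
Definition ninv (R : realType) (n : nat) (F : {poly R[i]}) : {poly R[i]} :=
  \poly_(k < n.+1) (F`_(n - k))^*.

Lemma horner_ninv (R : realType) (n : nat) (F : {poly R[i]}) (z : R[i]) :
  (size F <= n.+1)%N -> z != 0 ->
  (ninv n F).[z] = z ^+ n * (F.[1 / z^*])^*.
Proof.
move=> sF z0; rewrite /ninv horner_poly (horner_coef_wide _ sF) rmorph_sum /=.
rewrite mulr_sumr (reindex_inj rev_ord_inj) /=; apply: eq_bigr => i _.
have le_in : (i <= n)%N by rewrite -ltnS.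
rewrite subSS subKn // rmorphM rmorphXn div1r fmorphV /=.
rewrite (_ : Num.conj (conjc z) = z); last exact: conjcK.
by rewrite mulrCA exprVn -expfB_cond // (negbTE z0).
Qed.

Lemma horner_Fplus (R : realType) (lam : R) (F : {poly R[i]}) (z : R[i]) :
  (Fplus lam F).[z] = F.[expi (lam / 2) * z].
Proof. by rewrite horner_comp hornerZ hornerX. Qed.

Lemma horner_Fminus (R : realType) (lam : R) (F : {poly R[i]}) (z : R[i]) :
  (Fminus lam F).[z] = F.[expi (- (lam / 2)) * z].
Proof. by rewrite horner_comp hornerZ hornerX. Qed.

Lemma angle_expi (R : realType) (a b : R) :
  `|a - b| <= pi -> angle (expi a) (expi b) = `|a - b|.
Proof.
move=> ab; rewrite /angle /=.
have -> : cos a * cos b - sin a * - sin b = cos `|a - b|.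
  by rewrite cos_norm cosB mulrN opprK.
by rewrite cosK// in_itv /= normr_ge0.
Qed.

(* Main.v *)
Require Import Defs.
From HB Require Import structures.
From mathcomp Require Import all_boot all_order all_algebra complex.
From mathcomp Require Import boolp classical_sets reals topology normedtype.
From mathcomp Require Import trigo.
From mathcomp Require Import ring lra.

Import Order.TTheory GRing.Theory Num.Theory numFieldNormedType.Exports.
Local Open Scope classical_set_scope.
Local Open Scope ring_scope.
Local Open Scope complex_scope.

(** Write [f t] for the polynomial [F] at [expi t], divided by
    [expi (n * t / 2)].  When the zeros of [F] lie in the open disk, [f] has a
    continuous strictly increasing argument [A], the total phase, which gains
    [n * pi] over a period.  The two sides of the equivalence are two readings
    of one bound, the step bound [A (t + lam) - A t <= pi] for all [t].

    Zeros of combinations.  On the circle, [F + zeta *: ninv n F] is a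
    nonvanishing factor times [sin (A t - c)], where the level [c] depends on
    [zeta] only ([root_combination]).  Its zeros are thus the points where [A]
    meets [c] modulo [pi]; there are exactly [n] of them in a period
    ([combination_zeros]), and they are separated by [lam] for every [c]
    as soon as the step bound holds ([step_Tclosed]).

    The quotient.  At [expi (t + lam / 2)] the quotient has argument
    [A (t + lam) - A t] ([quot_total_phase]).  If its imaginary part is
    nonnegative on the circle, then this gain stays in [[0, pi]] modulo
    [2 * pi], hence in [[0, pi]] by continuity, because its mean is
    [n * lam / 2 < pi] ([total_phase_step_le_pi]).  A polynomial in [Dclosed]
    is only known to satisfy the inequality outside the disk, so the bound is
    proved on circles of radius greater than [1] and passed to the limit.  In
    the limit a zero on the circle becomes a jump of [A] by [pi], which
    exhausts the bound: then all the zeros are on the circle and separated,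
    that is, [F] is in [Tclosed] ([Dclosed_circle_Tclosed]).

    Conversely, if all the combinations are in [Tclosed], then [F] has no zero
    on the circle, since some combination would have a double zero there
    ([double_zero_combination]).  A polynomial in [Tclosed] is in [Dclosed]: the
    argument of its quotient at a point outside the disk is the phase gained
    over disjoint arcs which do not fill the circle ([Tclosed_Dclosed]).  At a
    fixed point outside the disk, the quotient of the combination is a Moebius
    function of [zeta] with value the quotient of [F] at [0], and it maps the
    unit circle into the upper half plane; hence it maps [0] there as well
    ([moebius_center]).

    The limit.  On the circle, the imaginary part of the quotient of [F] is, up
    to positive factors, a Wronskian of [F] and [ninv n F], unchanged when
    a multiple of [ninv n F] is added to [F].  At a point where the quotient is real
    this nonnegative function has a double zero, which determines the value
    left in the quotient of the combination once the common zero of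
    numerator and denominator is cancelled ([quot_limit]). *)

Set Implicit Arguments.
Unset Strict Implicit.
Unset Printing Implicit Defensive.

(** * Angles on the unit circle *)

Section UnitCircle.
Context {R : realType}.
Implicit Types (t u : R) (z w : R[i]).

Lemma expiD t u : expi (t + u) = expi t * expi u.
Proof.
by apply/eqP; rewrite eq_complex /= cosD sinD addrC (mulrC (sin t)) addrC eqxx /= addrC.
Qed.

Lemma expi0 : expi 0 = 1 :> R[i].
Proof. by rewrite /expi cos0 sin0. Qed.

Lemma expi_neq0 t : expi t != 0.
Proof.
apply/eqP => h; have := expiD t (- t).
by rewrite subrr expi0 h mul0r => /eqP; rewrite oner_eq0.
Qed.

Lemma expiN t : expi (- t) = (expi t)^-1.
Proof. by apply: (mulfI (expi_neq0 t)); rewrite -expiD subrr expi0 divff ?expi_neq0. Qed.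

Lemma conj_expi t : (expi t)^* = expi (- t).
Proof. by rewrite /expi /= cosN sinN. Qed.

Lemma norm_expi t : `|expi t| = 1.
Proof. by rewrite normc_def /= cos2Dsin2 sqrtr1. Qed.

Lemma expi2pi : expi (2 * pi) = 1 :> R[i].
Proof. by rewrite /expi mulr_natl cos2pi sin2pi. Qed.

Lemma expiM_nat n t : expi (n%:R * t) = expi t ^+ n.
Proof.
elim: n => [|n IH]; first by rewrite mul0r expi0.
by rewrite -natr1 mulrDl mul1r expiD IH exprSr.
Qed.

Lemma Im_scale (m : R) z : complex.Im (m%:C * z) = m * complex.Im z.
Proof. by case: z => x y /=; rewrite mul0r addr0. Qed.

Lemma Re_scale (m : R) z : complex.Re (m%:C * z) = m * complex.Re z.
Proof. by case: z => x y /=; rewrite mul0r subr0. Qed.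

Lemma ImD z w : complex.Im (z + w) = complex.Im z + complex.Im w.
Proof. by case: z; case: w. Qed.

Lemma ReD z w : complex.Re (z + w) = complex.Re z + complex.Re w.
Proof. by case: z; case: w. Qed.

Lemma conjcM z w : conjc (z * w) = conjc z * conjc w.
Proof. exact: rmorphM. Qed.

Lemma conjcB z w : conjc (z - w) = conjc z - conjc w.
Proof. exact: rmorphB. Qed.

Lemma unit_expi z : `|z| = 1 -> exists2 t, - pi <= t <= pi & z = expi t.
Proof.
case: z => x y; rewrite normc_def => -[h].
have {}h : x ^+ 2 + y ^+ 2 = 1.
  by rewrite -(@sqr_sqrtr _ (x ^+ 2 + y ^+ 2)) ?addr_ge0 ?sqr_ge0 // h expr1n.
have x1 : -1 <= x <= 1 by apply/andP; nra.
have ga := acos_ge0 x1; have la := acos_lepi x1.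
have ca : cos (acos x) = x by rewrite acosK // in_itv.
have sa : sin (acos x) = `|y|.
  by rewrite sin_acos // -h addrAC subrr add0r sqrtr_sqr.
have [y0|y0] := leP 0 y.
  by exists (acos x); [lra|rewrite /expi ca sa ger0_norm].
by exists (- acos x); [lra|rewrite /expi cosN sinN ca sa ltr0_norm // opprK].
Qed.

Lemma angleE z w : angle z w = acos (complex.Re (z * conjc w)).
Proof. by []. Qed.

Lemma angle_expi_min t u : `|u - t| <= 2 * pi ->
  angle (expi t) (expi u) = Num.min `|u - t| (2 * pi - `|u - t|).
Proof.
have -> : angle (expi t) (expi u) = acos (cos `|u - t|).
  rewrite angleE conj_expi -expiD /expi /= cos_norm -(cosN (t - u)).
  by congr (acos (cos _)); ring.
have := normr_ge0 (u - t); move: `|u - t| => d d0 d2.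
rewrite /Num.min; case: ifP => [h|/negbT]; last rewrite -leNgt => h.
  by rewrite cosK // in_itv /= d0 /=; lra.
rewrite -(cosN d) -(cosD2pi (- d)) -[pi *+ 2]mulr_natl addrC.
by rewrite cosK // in_itv /=; apply/andP; lra.
Qed.

Lemma expi_neq t u : 0 < `|u - t| < 2 * pi -> expi u != expi t.
Proof.
move=> /andP[d0 d1]; apply/eqP => e; have := angle_expi_min (ltW d1).
rewrite e angleE conj_expi -expiD subrr expi0 acos1 /Num.min.
by case: ifP => _; lra.
Qed.

Lemma angle_ge lam t u :
  lam <= `|u - t| -> `|u - t| <= 2 * pi - lam -> 0 < lam ->
  lam <= angle (expi t) (expi u).
Proof. by move=> h1 h2 l; rewrite angle_expi_min ?ge_min; [rewrite le_min; lra|lra]. Qed.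

Lemma angle_gt lam t u :
  lam < `|u - t| -> `|u - t| < 2 * pi - lam -> 0 < lam ->
  lam < angle (expi t) (expi u).
Proof. by move=> h1 h2 l; rewrite angle_expi_min; [rewrite lt_min; lra|lra]. Qed.

Lemma angle_le_pi z w : `|z| = 1 -> `|w| = 1 -> angle z w <= pi.
Proof.
move=> /unit_expi [t _ ->] /unit_expi [u _ ->].
rewrite angleE conj_expi -expiD /=; apply: acos_lepi.
by rewrite cos_geN1 cos_le1.
Qed.

Lemma angleC z w : angle z w = angle w z.
Proof. by rewrite /angle; congr acos; case: z; case: w => a b c d /=; ring. Qed.

Lemma lift_angle t z : `|z| = 1 ->
  exists2 u, `|u - t| = angle (expi t) z & z = expi u.
Proof.
move=> z1; have z1' : `|z * expi (- t)| = 1 by rewrite normrM z1 norm_expi mulr1.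
have [v hv e] := unit_expi z1'; have ez : z = expi (t + v).
  by rewrite expiD -e expiN mulrCA mulfV ?expi_neq0 // mulr1.
exists (t + v) => //; rewrite ez angle_expi; first by rewrite distrC.
by rewrite opprD addrA subrr sub0r normrN ler_norml.
Qed.

End UnitCircle.

(** * The phase of a linear factor *)

Section Phase.
Context {R : realType}.
Implicit Types (t u v : R) (z w a : R[i]).

(** A lift of the argument of [expi (t / 2) - a * expi (- t / 2)].  Pulling out
    [expi (t / 2)] leaves [1 - a * expi (- t)], which for [a] in the open disk
    stays in the right half plane, so that [atan] is a global branch. *)
Definition phase a t : R :=
  let w := 1 - a * expi (- t) in t / 2 + atan (complex.Im w / complex.Re w).

(** The condition under which [phase a t] is meaningful.  For [a] in the closed
    disk it only excludes [a = expi t]. *)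
Definition facing a t : bool := 0 < complex.Re (1 - a * expi (- t)).

Lemma norm_lt_real z (m : R) :
  (`|z| < m%:C) = (0 < m) && (complex.Re z ^+ 2 + complex.Im z ^+ 2 < m ^+ 2).
Proof.
rewrite normc_def ltcR; have [m0|m0] := ltP 0 m; last first.
  by apply/negbTE; rewrite -leNgt (le_trans m0) ?sqrtr_ge0.
rewrite /= -{1}(gtr0_norm m0) -sqrtr_sqr ltr_sqrt //.
by rewrite exprn_gt0.
Qed.

Lemma norm_le_real z (m : R) : 0 <= m ->
  (`|z| <= m%:C) = (complex.Re z ^+ 2 + complex.Im z ^+ 2 <= m ^+ 2).
Proof.
by move=> m0; rewrite normc_def lecR -{1}(ger0_norm m0) -sqrtr_sqr ler_sqrt // sqr_ge0.
Qed.

Lemma facing_disk a t : `|a| < 1 -> facing a t.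
Proof.
move=> a1; have : `|a * expi (- t)| < 1%:C by rewrite normrM norm_expi mulr1.
rewrite norm_lt_real /facing; case: (a * _) => x y /= /andP[_]; nra.
Qed.

Lemma facing_closed_disk a t : `|a| <= 1 -> a != expi t -> facing a t.
Proof.
move=> a1 at1; have : `|a * expi (- t)| <= 1%:C by rewrite normrM norm_expi mulr1.
have : a * expi (- t) != 1.
  apply: contra at1 => /eqP h; rewrite -[a]mulr1 -(mulfV (expi_neq0 t)).
  by rewrite mulrCA -expiN h mulr1.
rewrite norm_le_real // /facing; case: (a * _) => x y /=; rewrite eq_complex /=.
move=> h1 h2; rewrite subr_gt0 lt_neqAle; apply/andP; split; last by nra.
by apply: contra h1 => /eqP ex; rewrite ex eqxx /=; apply/eqP; move: h2; rewrite ex; nra.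
Qed.

Lemma polar_half_plane w : 0 < complex.Re w ->
  exists2 m, 0 < m & w = m%:C * expi (atan (complex.Im w / complex.Re w)).
Proof.
move=> w0; set th := atan _.
have c0 : 0 < cos th by rewrite /th cos_atan invr_gt0 sqrtr_gt0 ltr_pwDl ?sqr_ge0.
exists (complex.Re w / cos th); first exact: divr_gt0.
apply/eqP; rewrite eq_complex Re_scale Im_scale /=; apply/andP; split; apply/eqP.
  by rewrite divfK ?gt_eqF.
rewrite mulrAC -mulrA -/(tan th) /th atanK mulrC divfK // gt_eqF //.
Qed.

Lemma phase_polar a t : facing a t ->
  exists2 m, 0 < m & expi t - a = m%:C * expi (t / 2 + phase a t).
Proof.
move=> /polar_half_plane [m m0 e]; exists m => //.
have -> : expi t - a = expi t * (1 - a * expi (- t)).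
  by rewrite mulrBr mulr1 mulrCA -expiD subrr expi0 mulr1.
rewrite {1}e mulrCA -expiD /phase /=; congr (_ * expi _).
by rewrite addrA -splitr.
Qed.

(** Expanding
    [(expi u - a) * conjc (expi t - a) * expi (- (u - t) / 2)] leaves, besides
    [expi ((u - t) / 2)] and [|a|^2] times its conjugate, only a real term.
    This avoids differentiating the phase: the sign of the sine of an
    increment is explicit. *)
Lemma phase_sincos a t u : facing a t -> facing a u ->
  exists2 m, 0 < m &
    m * sin (phase a u - phase a t) =
      (1 - (complex.Re a ^+ 2 + complex.Im a ^+ 2)) * sin ((u - t) / 2) /\
    m * cos (phase a u - phase a t) =
      (1 + (complex.Re a ^+ 2 + complex.Im a ^+ 2)) * cos ((u - t) / 2)
      - 2 * complex.Re (a * expi (- ((u + t) / 2))).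
Proof.
move=> /phase_polar [m m0 et] /phase_polar [k k0 eu]; exists (k * m); first exact: mulr_gt0.
set d := phase a u - phase a t.
have e1 : (expi u - a) * conjc (expi t - a) * expi (- ((u - t) / 2)) =
   (k * m)%:C * expi d.
  rewrite eu et conjcM conjc_real conj_expi [(k * m)%:C]rmorphM.
  have -> : d = (u / 2 + phase a u) + - (t / 2 + phase a t) + - ((u - t) / 2).
    by rewrite /d; lra.
  rewrite 2!(expiD _ (- _)); ring.
have e2 : (expi u - a) * conjc (expi t - a) * expi (- ((u - t) / 2)) =
   expi ((u - t) / 2) + a * conjc a * expi (- ((u - t) / 2)) -
   (a * expi (- ((u + t) / 2)) + conjc (a * expi (- ((u + t) / 2)))).
  rewrite conjcB conjcM !conj_expi opprK.
  have -> : expi u = expi (u / 2) * expi (u / 2) by rewrite -expiD -splitr.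
  have -> : expi (- t) = expi (- (t / 2)) * expi (- (t / 2)).
    by rewrite -expiD; congr expi; lra.
  have -> : (u - t) / 2 = u / 2 + - (t / 2) by lra.
  have -> : (u + t) / 2 = u / 2 + t / 2 by lra.
  rewrite !opprD !expiD !opprK !expiN.
  have := expi_neq0 (u / 2); have := expi_neq0 (t / 2).
  move: (expi (u / 2)) (expi (t / 2)) (conjc a) => p q b q0 p0.
  by field; rewrite p0 q0.
move: e2; rewrite e1 => e2; move: (congr1 (@complex.Re R) e2) (congr1 (@complex.Im R) e2).
rewrite Re_scale Im_scale /= => -> ->; clear.
case: a => x y /=; rewrite cosN sinN; split; ring.
Qed.

Lemma phase_dist a t u :
  (u - t) / 2 - pi < phase a u - phase a t < (u - t) / 2 + pi.
Proof.
rewrite /phase /=; set x := _ / complex.Re _; set y := _ / complex.Re _.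
have := atan_gtNpi2 x; have := atan_ltpi2 x; have := atan_gtNpi2 y; have := atan_ltpi2 y.
by move=> *; apply/andP; split; lra.
Qed.

Lemma phaseD2pi a t : phase a (t + 2 * pi) = phase a t + pi.
Proof.
rewrite /phase opprD expiD (expiN (2 * pi)) expi2pi invr1 mulr1; lra.
Qed.

Lemma sin_le0_Npi0 v : - pi <= v <= 0 -> sin v <= 0.
Proof. by move=> h; rewrite -oppr_ge0 -sinN; apply: sin_ge0_pi; lra. Qed.

(** For a step shorter than a period the sine of the increment is positive,
    and the bounds on [atan] leave no room for an increment below [- pi]; a
    longer step is increasing by those bounds alone. *)
Lemma lt_phase a : `|a| < 1 -> {homo phase a : t u / t < u}.
Proof.
move=> a1 t u tu; have /andP[lo hi] := phase_dist a t u.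
have [m m0 [hs _]] := phase_sincos (facing_disk t a1) (facing_disk u a1).
move: a1; rewrite (_ : 1 = 1%:C) // norm_lt_real expr1n => /andP[_ n1].
rewrite -subr_gt0 ltNge; apply/negP => le0.
have [h|h] := leP (2 * pi) (u - t); first by lra.
have : 0 < sin ((u - t) / 2) by apply: sin_gt0_pi; lra.
have : sin (phase a u - phase a t) <= 0 by apply: sin_le0_Npi0; lra.
nra.
Qed.

(** When [|a| = 1], [phase_sincos] makes the sine of the increment vanish, so the
    increment is a multiple of [pi]; the sign of its cosine singles out [pi]. *)
Lemma phase_jump (al t u : R) : t < al < u -> u < t + 2 * pi ->
  phase (expi al) u - phase (expi al) t = pi.
Proof.
move=> /andP[ta au] ut; have /andP[lo hi] := phase_dist (expi al) t u.
have [||m m0 [hs hc]] := @phase_sincos (expi al) t u.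
- by apply: facing_closed_disk; [rewrite norm_expi|apply: expi_neq; rewrite gtr0_norm; lra].
- by apply: facing_closed_disk; [rewrite norm_expi|apply: expi_neq; rewrite ltr0_norm; lra].
move: hs hc; rewrite -expiD /= cos2Dsin2 subrr mul0r => hs hc.
have {}hs : sin (phase (expi al) u - phase (expi al) t) = 0.
  by move/eqP: hs; rewrite mulf_eq0 gt_eqF //= => /eqP.
have {}hc : cos (phase (expi al) u - phase (expi al) t) < 0.
  suff : cos ((u - t) / 2) < cos (al - (u + t) / 2) by nra.
  rewrite -(cos_norm (al - _)).
  have hd : `|al - (u + t) / 2| < (u - t) / 2 by rewrite ltr_norml; lra.
  have hd0 := normr_ge0 (al - (u + t) / 2).
  by rewrite ltr_cos // in_itv /=; lra.
set d := phase _ _ - _ in lo hi hs hc *.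
have [h1|h1] := leP d 0.
  have [h2|h2] := ltP (- (pi / 2)) d.
    by have := @cos_gt0_pihalf R d; rewrite h2; lra.
  have : 0 < sin (- d) by apply: sin_gt0_pi; lra.
  by rewrite sinN hs; lra.
have [h2|h2] := ltP d pi; first by have := @sin_gt0_pi R d; rewrite h1 h2 => /(_ isT); lra.
have [h3|h3] := ltP pi d; last by lra.
have : 0 < sin (d - pi) by apply: sin_gt0_pi; lra.
by rewrite sinB hs cospi sinpi; lra.
Qed.

(** Exchanges the roles of the zero and of the point of evaluation: for a fixed
    modulus [r], the increments of the phase depend on the difference of the
    two arguments only. *)
Lemma phase_rotation (r al t : R) :
  phase (r%:C * expi al) t = al / 2 + phase r%:C (t - al).
Proof.
rewrite /phase -mulrA -expiD (_ : al - t = - (t - al)); last lra.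
lra.
Qed.

End Phase.

(** * The total phase of a list of zeros *)

Section TotalPhase.
Context {R : realType}.
Implicit Types (t v : R) (a : R[i]) (s : seq R[i]).

Definition in_disk : pred R[i] := fun a => `|a| < 1.

Definition total_phase s t : R := \sum_(a <- s) phase a t.

Lemma total_phase_nil t : total_phase [::] t = 0.
Proof. exact: big_nil. Qed.

Lemma total_phase_cons a s t : total_phase (a :: s) t = phase a t + total_phase s t.
Proof. exact: big_cons. Qed.

Lemma continuous_phase a : in_disk a -> continuous (phase a).
Proof.
move=> a1 t; have := facing_disk t a1; rewrite /phase /facing; case: a {a1} => x y /=.
set re := (X in 0 < X -> _) => re0.
have cNt : {for t, continuous (fun u : R => - u)} by exact: opp_continuous.
have cc : (fun u : R => cos (- u)) @ t --> cos (- t).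
  by apply: continuous_comp => //; exact: continuous_cos.
have cs : (fun u : R => sin (- u)) @ t --> sin (- t).
  by apply: continuous_comp => //; exact: continuous_sin.
apply: cvgD; first by apply: cvgMl; exact: cvg_id.
apply: (cvg_comp _ (@atan R) _ (@continuous_atan R _)).
apply: cvgM; last apply: cvgV; rewrite ?gt_eqF //.
- apply: cvgB; first exact: cvg_cst.
  by apply: cvgD; apply: cvgMr.
- apply: cvgB; first exact: cvg_cst.
  by apply: cvgB; apply: cvgMr.
Qed.

(** The condition [facing] keeps [1 - a * expi (- t)] away from the imaginary
    axis even if [a] is on the circle; hence the zeros can be moved back to the
    circle in the limit. *)
Lemma cvg_phase_shrink a t : facing a t ->
  (fun r : R => phase (r%:C * a) t) @ (1 : R) --> phase a t.
Proof.
rewrite /phase /facing; set b := a * _.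
under eq_fun do rewrite -mulrA -/b.
case: b => x y /= => b0.
apply: cvgD; first exact: cvg_cst.
apply: (cvg_comp _ (@atan R) _ (@continuous_atan R _)).
have cx (z : R) : (fun r : R => r * z) @ (1 : R) --> z.
  by rewrite -{2}[z]mul1r; apply: cvgMl; exact: cvg_id.
have c0 (z : R) : (fun r : R => 0 * z) @ (1 : R) --> (0 : R).
  by under eq_fun do rewrite mul0r; exact: cvg_cst.
apply: cvgM; last apply: cvgV; rewrite ?gt_eqF //.
- apply: cvgB; first exact: cvg_cst.
  by rewrite -[X in _ --> X]addr0; apply: cvgD; [exact: cx|exact: c0].
- apply: cvgB; first exact: cvg_cst.
  by rewrite -[X in _ --> X]subr0; apply: cvgB; [exact: cx|exact: c0].
Qed.

Lemma cvg_total_phase_shrink s t : all (fun a => facing a t) s ->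
  (fun r : R => total_phase [seq r%:C * a | a <- s] t) @ (1 : R) --> total_phase s t.
Proof.
elim: s => [_|a s IH /= /andP[fa fs]].
  by under eq_fun do rewrite /= total_phase_nil; rewrite total_phase_nil; exact: cvg_cst.
under eq_fun do rewrite total_phase_cons; rewrite total_phase_cons.
by apply: cvgD; [exact: cvg_phase_shrink|exact: IH].
Qed.

Lemma continuous_total_phase s : all in_disk s -> continuous (total_phase s).
Proof.
move=> + t; elim: s => [_|a s IH /= /andP[fa fs]].
  have -> : total_phase [::] = (fun=> 0) by apply/funext => u; rewrite total_phase_nil.
  exact: cvg_cst.
have -> : total_phase (a :: s) = phase a \+ total_phase s.
  by apply/funext => u; rewrite total_phase_cons.
by apply: cvgD; [exact: continuous_phase|exact: IH].
Qed.

Lemma total_phaseD2pi s t :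
  total_phase s (t + 2 * pi) = total_phase s t + (size s)%:R * pi.
Proof.
elim: s => [|a s IH]; first by rewrite !total_phase_nil mul0r addr0.
by rewrite !total_phase_cons IH phaseD2pi /= -natr1; ring.
Qed.

Lemma le_total_phase s : all in_disk s -> {homo total_phase s : t u / t <= u}.
Proof.
move=> sD t u; rewrite le_eqVlt => /predU1P[->//|tu]; rewrite /total_phase !big_seq.
by apply: ler_sum => a /(allP sD) aD; exact/ltW/lt_phase.
Qed.

Lemma lt_total_phase s : all in_disk s -> s != [::] ->
  {homo total_phase s : t u / t < u}.
Proof.
case: s => // a s /= /andP[aD sD] _ t u tu; rewrite !total_phase_cons.
by apply: ltr_leD; [exact: lt_phase|exact/le_total_phase/ltW].
Qed.

Lemma total_phase_bound s t :
  (size s)%:R * ((t - pi) / 2) <= total_phase s t <= (size s)%:R * ((t + pi) / 2).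
Proof.
elim: s => [|a s /andP[lo hi]]; first by rewrite total_phase_nil !mul0r lexx.
rewrite total_phase_cons /= -natr1 !(mulrDl (size s)%:R) !mul1r /phase /=.
set x := _ / complex.Re _.
have := atan_gtNpi2 x; have := atan_ltpi2 x => *.
by apply/andP; split; lra.
Qed.

Lemma total_phase_surj s v : all in_disk s -> s != [::] ->
  exists t, total_phase s t = v.
Proof.
move=> sD s0; have n1 : 1 <= (size s)%:R :> R by rewrite ler1n lt0n size_eq0.
pose b := 2 * `|v| + pi; have v0 := normr_ge0 v; have p0 := pi_gt0 R.
have /andP[_ hi] := total_phase_bound s (- b); have /andP[lo _] := total_phase_bound s b.
have vv : - `|v| <= v <= `|v| by rewrite -ler_norml.
have [|||c _ <-] := @IVT R (total_phase s) (- b) b v; last by exists c.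
- by rewrite /b; lra.
- by apply: continuous_subspaceT; exact: continuous_total_phase.
- rewrite le_max ge_min; apply/andP; split; apply/orP; [left|right].
    by rewrite (le_trans hi) // /b; nra.
  by rewrite (le_trans _ lo) // /b; nra.
Qed.

(** The increment over a step [lam] is everywhere congruent modulo [2 * pi] to
    a point of [[0, pi]], so by continuity it cannot cross from [[0, pi]] into
    the next admissible interval.  It is less than [pi] somewhere because
    [size s] steps of length [lam] fit strictly into one period, over which
    the phase gains only [size s] times [pi]. *)
Lemma total_phase_step_le_pi s (lam : R) : all in_disk s -> s != [::] ->
  0 < lam < 2 * pi / (size s)%:R ->
  (forall t, 0 <= sin (total_phase s (t + lam) - total_phase s t)) ->
  forall t, total_phase s (t + lam) - total_phase s t <= pi.
Proof.
move=> sD s0 /andP[lam0 lam1] hsin t.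
have n0 : 0 < (size s)%:R :> R by rewrite ltr0n lt0n size_eq0.
pose D u := total_phase s (u + lam) - total_phase s u.
have [j hj] : exists j : nat, D (j%:R * lam) < pi.
  apply: contrapT => /forallNP nD.
  have {}nD j : pi <= D (j%:R * lam) by rewrite leNgt; apply/negP/nD.
  have steps k : k%:R * pi <= total_phase s (k%:R * lam) - total_phase s 0.
    elim: k => [|k IH]; first by rewrite !mul0r subrr.
    have := nD k; rewrite /D -natr1 !mulrDl !mul1r; lra.
  have := steps (size s); rewrite lerBrDl leNgt => /negP; apply.
  rewrite -total_phaseD2pi add0r.
  by apply: lt_total_phase => //; rewrite mulrC -ltr_pdivlMr.
have cD : continuous D.
  move=> u; apply: cvgB; last exact: continuous_total_phase.
  apply: (@continuous_comp _ _ _ (fun u : R => u + lam) (total_phase s)); last first.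
    exact: continuous_total_phase.
  by apply: cvgD; [exact: cvg_id|exact: cvg_cst].
rewrite leNgt; apply/negP; rewrite -/(D t) => ht.
pose v := Num.min (D t) (pi + pi / 2).
have p0 := pi_gt0 R.
have /andP[v1 v2] : pi < v <= pi + pi / 2 by rewrite /v lt_min ht ge_min lexx orbT; lra.
have v3 : v <= D t by rewrite /v ge_min lexx.
have [c hc] : exists c, D c = v.
  set x := j%:R * lam in hj.
  have cDw (a b : R) : {within `[a, b], continuous D} by exact: continuous_subspaceT.
  have [h|/ltW h] := leP x t.
    have [|c _ e] := IVT h (cDw _ _) (v := v); last by exists c.
    by rewrite ge_min le_max v3 orbT andbT; apply/orP; left; lra.
  have [|c _ e] := IVT h (cDw _ _) (v := v); last by exists c.
  by rewrite ge_min le_max v3 /= andbT; apply/orP; right; lra.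
have := hsin c; rewrite -/(D c) hc leNgt => /negP; apply.
rewrite -[v](subrK pi) sinDpi oppr_lt0; apply: sin_gt0_pi; lra.
Qed.

End TotalPhase.

(** * Polynomials on circles around the origin *)

Section CirclePolynomials.
Context {R : realType}.
Implicit Types (t u c rho r : R) (z zeta : R[i]) (s : seq R[i]) (F : {poly R[i]}).

Lemma zeros_exist F : exists s, zeros_of F s.
Proof. by have [s hs] := closed_field_poly_normal F; exists s. Qed.

Lemma horner_zeros F s z : zeros_of F s ->
  F.[z] = lead_coef F * \prod_(a <- s) (z - a).
Proof.
move=> h; rewrite {1}h hornerZ horner_prod; congr (_ * _).
by apply: eq_bigr => a _; rewrite hornerXsubC.
Qed.

Lemma root_zeros F s : F != 0 -> zeros_of F s -> root F =i s.
Proof.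
move=> F0 h z; rewrite -topredE /= {1}h rootZ ?lead_coef_eq0 //.
by rewrite root_prod_XsubC.
Qed.

Lemma size_zeros F s : F != 0 -> zeros_of F s -> size F = (size s).+1.
Proof. by move=> F0 h; rewrite {1}h size_scale ?lead_coef_eq0 // size_prod_XsubC. Qed.

Lemma ltr0C r : (0 < r%:C) = (0 < r).
Proof. exact: (ltcR 0 r). Qed.

Lemma norm_div_lt1 rho z : 0 < rho -> (`|z / rho%:C| < 1) = (`|z| < rho%:C).
Proof.
move=> r0; have nr : `|rho%:C| = rho%:C by rewrite gtr0_norm // ltr0C.
by rewrite normrM normfV nr ltr_pdivrMr ?ltr0C // mul1r.
Qed.

Lemma map_divr1 s : [seq a / (1 : R)%:C | a <- s] = s.
Proof. by rewrite -[RHS]map_id; apply: eq_map => a; rewrite divr1. Qed.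

Lemma prod_total_phase s t : all (fun a => facing a t) s ->
  exists2 m : R, 0 < m & \prod_(a <- s) (expi t - a) =
    m%:C * expi ((size s)%:R * t / 2 + total_phase s t).
Proof.
elim: s => [_|a s IH /= /andP[/phase_polar [k k0 ek] /IH [m m0 em]]].
  by exists 1 => //; rewrite big_nil total_phase_nil !mul0r addr0 expi0 mulr1.
exists (k * m); first exact: mulr_gt0.
rewrite big_cons ek em total_phase_cons [(k * m)%:C]rmorphM mulrACA -expiD.
by congr (_ * expi _); rewrite -natr1; lra.
Qed.

Lemma horner_total_phase F s rho t : zeros_of F s -> 0 < rho ->
  all (fun a => facing a t) [seq a / rho%:C | a <- s] ->
  exists2 m : R, 0 < m & F.[rho%:C * expi t] = lead_coef F *
    (m%:C * expi ((size s)%:R * t / 2 + total_phase [seq a / rho%:C | a <- s] t)).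
Proof.
move=> h r0 /prod_total_phase [m m0]; rewrite big_map size_map => e.
exists (rho ^+ size s * m); first by rewrite mulr_gt0 // exprn_gt0.
have rC0 : rho%:C != 0 by rewrite eq_complex /= eqxx andbT gt_eqF.
rewrite (horner_zeros _ h) [(_ * m)%:C]rmorphM rmorphXn /= -[_ * _ * expi _]mulrA -e.
congr (_ * _); elim: (s) => [|a s' IH]; first by rewrite !big_nil mulr1.
by rewrite !big_cons IH exprS /= ; field.
Qed.

(** The half angles in the arguments of numerator and denominator differ by
    [n * lam / 2], which the factor in front of the quotient compensates. *)
Lemma quot_total_phase n lam F s rho u :
  zeros_of F s -> size F = n.+1 -> 0 < rho ->
  all in_disk [seq a / rho%:C | a <- s] ->
  exists2 m : R, 0 < m & quot n lam F (rho%:C * expi u) =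
    m%:C * expi (total_phase [seq a / rho%:C | a <- s] (u + lam / 2) -
                 total_phase [seq a / rho%:C | a <- s] (u - lam / 2)).
Proof.
move=> h sF r0; set s' := map _ _ => sD.
have F0 : F != 0 by rewrite -size_poly_gt0 sF.
have sn : size s = n by have := size_zeros F0 h; rewrite sF => -[].
have fac t : all (fun a => facing a t) s' by apply: sub_all sD => a; exact: facing_disk.
have [m m0 em] := horner_total_phase h r0 (fac (u + lam / 2)).
have [k k0 ek] := horner_total_phase h r0 (fac (u - lam / 2)).
exists (m / k); first exact: divr_gt0.
have turn v : expi v * (rho%:C * expi u) = rho%:C * expi (u + v).
  by rewrite mulrCA -expiD addrC.
rewrite /quot horner_Fplus horner_Fminus !turn em ek -/s' sn.
set A := total_phase _ _; set B := total_phase _ _.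
have -> : n%:R * (u + lam / 2) / 2 + A =
    (n%:R * (u - lam / 2) / 2 + B) + n%:R * lam / 2 + (A - B).
  by field.
rewrite [expi (_ + _ + _)]expiD [expi (_ + _ + _ * _ / 2)]expiD expiN fmorph_div /=.
have l0 : lead_coef F != 0 by rewrite lead_coef_eq0.
have kC0 : k%:C != 0 by rewrite eq_complex /= eqxx andbT gt_eqF.
have := expi_neq0 (n%:R * (u - lam / 2) / 2 + B); have := expi_neq0 (n%:R * lam / 2).
move: (expi (n%:R * (u - lam / 2) / 2 + B)) (expi (n%:R * lam / 2)) => p q q0 p0.
by field; rewrite p0 q0 kC0 l0.
Qed.

Lemma conjc_norm1 z : `|z| = 1 -> conjc z = z^-1.
Proof. by move=> /unit_expi [t _ ->]; rewrite conj_expi expiN. Qed.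

Lemma horner_ninvE n F z : (size F <= n.+1)%N -> z != 0 ->
  (ninv n F).[z] = z ^+ n * conjc F.[1 / conjc z].
Proof. exact: horner_ninv. Qed.

Lemma horner_ninv_circle n F z : (size F <= n.+1)%N -> `|z| = 1 ->
  (ninv n F).[z] = z ^+ n * conjc F.[z].
Proof.
move=> sF z1; have z0 : z != 0 by rewrite -normr_eq0 z1 oner_eq0.
by rewrite horner_ninvE // (conjc_norm1 z1) div1r invrK.
Qed.

Lemma conjc_prod (I : Type) (r : seq I) (f : I -> R[i]) :
  conjc (\prod_(i <- r) f i) = \prod_(i <- r) conjc (f i).
Proof. exact: rmorph_prod. Qed.

(** Outside the disk the [n]-inverse is dominated, factor by factor:
    [|1 - conj a z| <= |z - a|] when [|a| <= 1 <= |z|]. *)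
Lemma norm_ninv_le n F z : size F = n.+1 -> (forall a, root F a -> `|a| <= 1) ->
  1 < `|z| -> `|(ninv n F).[z]| <= `|F.[z]|.
Proof.
move=> sF hD z1; have F0 : F != 0 by rewrite -size_poly_gt0 sF.
have z0 : z != 0 by rewrite -normr_gt0 (lt_trans ltr01).
have [s hs] := zeros_exist F.
have sn : size s = n by have := size_zeros F0 hs; rewrite sF => -[].
rewrite horner_ninvE ?sF // !(horner_zeros _ hs) conjcM conjc_prod.
have -> : z ^+ n * (conjc (lead_coef F) * \prod_(a <- s) conjc (1 / conjc z - a))
    = conjc (lead_coef F) * \prod_(a <- s) (1 - conjc a * z).
  rewrite mulrCA -sn; congr (_ * _); elim: (s) => [|a s' IH].
    by rewrite !big_nil mulr1.
  by rewrite !big_cons -IH conjcB div1r fmorphV /= conjcK exprS; field.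
rewrite !normrM normcJ ler_wpM2l // !normr_prod big_seq [leRHS]big_seq.
apply: ler_prod => a as_; rewrite normr_ge0 /=.
have {}as_ : `|a| <= 1%:C by apply: hD; move: as_; rewrite -(root_zeros F0 hs).
have {}z1 : ~~ (`|z| <= 1%:C) by rewrite lt_geF.
rewrite (norm_le_real a ler01) expr1n in as_.
rewrite (norm_le_real z ler01) expr1n -ltNge in z1.
rewrite -(ler_pXn2r (n := 2)) ?nnegrE //= -!add_Re2_Im2 lecR.
move: as_ z1; case: a => x y; case: (z) => p q /=; nra.
Qed.

(** The leading factors of [zeta *: ninv n F] and of [F] have a unimodular ratio;
    half the argument of its opposite is the level at which the phase of [F]
    is cut. *)
Lemma unimodular_level (l zeta : R[i]) : l != 0 -> `|zeta| = 1 ->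
  exists c, zeta * conjc l = - (l * expi (2 * c)).
Proof.
move=> l0 z1; have [|t _ ht] := @unit_expi R (- (zeta * conjc l / l)).
  by rewrite normrN !normrM normfV normcJ z1 mul1r divff ?normr_eq0.
exists (t / 2); have -> : 2 * (t / 2) = t by lra.
by rewrite -ht mulrN opprK [RHS]mulrC divfK.
Qed.

(** On the circle [F] and [ninv n F] have, up to a common factor, conjugate
    values, with phases [A t] and [- A t]; their combination is therefore a
    nonvanishing factor times [sin (A t - c)]. *)
Lemma root_combination n F s zeta c t :
  zeros_of F s -> size F = n.+1 -> all in_disk s ->
  zeta * conjc (lead_coef F) = - (lead_coef F * expi (2 * c)) ->
  root (F + zeta *: ninv n F) (expi t) = (sin (total_phase s t - c) == 0).
Proof.
move=> h sF sD hz; have F0 : F != 0 by rewrite -size_poly_gt0 sF.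
have l0 : lead_coef F != 0 by rewrite lead_coef_eq0.
have sn : size s = n by have := size_zeros F0 h; rewrite sF => -[].
have [|m m0] := @horner_total_phase F s 1 t h ltr01.
  by rewrite map_divr1; apply: sub_all sD => a; exact: facing_disk.
rewrite map_divr1 mul1r sn => e.
rewrite /root hornerD hornerZ horner_ninv_circle ?sF ?norm_expi // e.
rewrite !conjcM conjc_real conj_expi -expiM_nat.
set A := total_phase s t; set w := n%:R * t / 2.
have -> : n%:R * t = w + w by rewrite /w; lra.
have -> : lead_coef F * (m%:C * expi (w + A)) +
   zeta * (expi (w + w) * (conjc (lead_coef F) * (m%:C * expi (- (w + A)))))
  = lead_coef F * m%:C * expi (w + c) * (expi (A - c) - expi (- (A - c))).
  transitivity (lead_coef F * (m%:C * expi (w + A)) +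
   zeta * conjc (lead_coef F) * (expi (w + w) * (m%:C * expi (- (w + A))))).
    by ring.
  rewrite hz (_ : 2 * c = c + c); last by lra.
  rewrite !opprD !opprK !expiD !expiN.
  have := expi_neq0 w; have := expi_neq0 A; have := expi_neq0 c.
  move: (expi w) (expi A) (expi c) => p q r r0 q0 p0.
  by field; rewrite p0 q0 r0.
have mC0 : m%:C != 0 by rewrite eq_complex /= eqxx andbT gt_eqF.
rewrite !mulf_eq0 (negbTE l0) (negbTE mC0) (negbTE (expi_neq0 _)) /=.
by rewrite eq_complex /= cosN sinN subrr eqxx /= opprK -mulr2n mulrn_eq0.
Qed.

(** The level set of the total phase modulo [pi] has exactly [n] points in a
    period; they account for all the zeros. *)
Lemma combination_zeros n F s zeta : (0 < n)%N ->
  zeros_of F s -> size F = n.+1 -> all in_disk s -> `|zeta| = 1 ->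
  exists T : nat -> R, let G := F + zeta *: ninv n F in
    [/\ forall j k, (j < k < n)%N ->
          pi <= total_phase s (T k) - total_phase s (T j) /\
          pi <= total_phase s (T j + 2 * pi) - total_phase s (T k),
        size G = n.+1 & zeros_of G [seq expi (T k) | k <- iota 0 n]].
Proof.
move=> n0 h sF sD z1; have F0 : F != 0 by rewrite -size_poly_gt0 sF.
have l0 : lead_coef F != 0 by rewrite lead_coef_eq0.
have sn : size s = n by have := size_zeros F0 h; rewrite sF => -[].
have s0 : s != [::] by rewrite -size_eq0 sn -lt0n.
have [c hc] := unimodular_level l0 z1.
have /choice [T hT] : forall k : nat, exists t, total_phase s t = c + k%:R * pi.
  by move=> k; exact: total_phase_surj.
exists T; set G := F + _; have p0 := pi_gt0 R.
have hroot t := root_combination t h sF sD hc.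
have G0 : G != 0.
  have [t ht] := total_phase_surj (c + pi / 2) sD s0.
  apply/eqP => G0; have := hroot t.
  by rewrite -/G G0 root0 ht addrAC subrr add0r sin_pihalf oner_eq0.
have sG : (size G <= n.+1)%N.
  rewrite (leq_trans (size_polyD _ _)) // geq_max sF leqnn /=.
  by rewrite (leq_trans (size_scale_leq _ _)) // size_poly.
have gap j k : (j < k < n)%N ->
    pi <= total_phase s (T k) - total_phase s (T j) /\
    pi <= total_phase s (T j + 2 * pi) - total_phase s (T k).
  move=> /andP[jk kn]; rewrite total_phaseD2pi sn !hT.
  have : j%:R + 1 <= k%:R :> R by rewrite natr1 ler_nat.
  have : k%:R + 1 <= n%:R :> R by rewrite natr1 ler_nat.
  have : 0 <= j%:R :> R by [].
  by split; nra.
have Tinc j k : (j < k < n)%N -> 0 < T k - T j < 2 * pi.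
  move=> /gap[g1 g2]; apply/andP; split.
    by rewrite subr_gt0 ltNge; apply/negP => /(le_total_phase sD); lra.
  by rewrite ltrBlDr ltNge addrC; apply/negP => /(le_total_phase sD); lra.
have uT : uniq [seq expi (T k) | k <- iota 0 n].
  rewrite map_inj_in_uniq ?iota_uniq // => j k; rewrite !mem_iota /= !add0n => jn kn.
  apply: contra_eq => jk; case: (ltngtP j k) jk => // jk _.
    have /Tinc : (j < k < n)%N by rewrite jk.
    by rewrite eq_sym => ?; apply: expi_neq; rewrite gtr0_norm; lra.
  have /Tinc : (k < j < n)%N by rewrite jk.
  by move=> ?; apply: expi_neq; rewrite gtr0_norm; lra.
have rT : all (root G) [seq expi (T k) | k <- iota 0 n].
  apply/allP => _ /mapP[k _ ->]; rewrite hroot hT addrAC subrr add0r.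
  elim: k => [|k IH]; first by rewrite mul0r sin0.
  by rewrite -natr1 mulrDl mul1r sinDpi oppr_eq0.
have {}sG : size G = n.+1.
  apply/eqP; rewrite eqn_leq sG /=.
  by have := max_poly_roots G0 rT uT; rewrite size_map size_iota.
split=> //; apply: all_roots_prod_XsubC => //; last by rewrite uniq_rootsE.
by rewrite size_map size_iota.
Qed.

End CirclePolynomials.

(** * From the step bound to separated zeros *)

Section Separation.
Context {R : realType}.
Implicit Types (t u lam : R) (zeta : R[i]) (s : seq R[i]) (F G : {poly R[i]}).

Lemma perm_pairwise (T : eqType) (e : rel T) (s t : seq T) :
  symmetric e -> perm_eq s t -> pairwise e s -> pairwise e t.
Proof.
move=> eC; elim: t s => [|x t IH] s st; first by move: (perm_size st); case: s {st}.
have xs : x \in s by rewrite (perm_mem st) mem_head.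
case/splitPr: xs st => s1 s2 st.
have {}st : perm_eq (s1 ++ s2) t by move: st; rewrite -[x :: s2]cat1s perm_catCA /= perm_cons.
rewrite pairwise_cat allrel_consr /= => /and3P[/andP[h1 h2] h3 /andP[h4 h5]].
rewrite (IH _ st) ?pairwise_cat ?h2 ?h3 // andbT -(perm_all _ st) all_cat h4 andbT.
by apply: sub_all h1 => y; rewrite eC.
Qed.

Lemma pairwise_iota (e : rel R[i]) (T : nat -> R) n :
  (forall j k, (j < k < n)%N -> e (expi (T j)) (expi (T k))) ->
  pairwise e [seq expi (T k) | k <- iota 0 n].
Proof.
move=> h; rewrite pairwise_map.
apply: (@sub_in_pairwise _ [pred k | (k < n)%N] ltn); last 2 first.
- by apply/allP => k; rewrite mem_iota.
- by rewrite -(sorted_pairwise ltn_trans) iota_ltn_sorted.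
- by move=> j k _ kn jk; apply: h; apply/andP.
Qed.

Lemma polys_in_circle n G (T : nat -> R) : size G = n.+1 ->
  zeros_of G [seq expi (T k) | k <- iota 0 n] -> polys_in n (@unit_circle R) G.
Proof.
move=> sG hG; split=> // z; have G0 : G != 0 by rewrite -size_poly_gt0 sG.
have := root_zeros G0 hG z; rewrite -topredE /= => -> /mapP[k _ ->].
exact: norm_expi.
Qed.

(** Distinct points of one level modulo [pi] differ by at least [pi] in phase,
    and a step shorter than [lam] does not achieve that. *)
Lemma level_gap s lam t u : all in_disk s -> s != [::] ->
  (forall v, total_phase s (v + lam) - total_phase s v <= pi) ->
  pi <= total_phase s u - total_phase s t -> lam <= u - t.
Proof.
move=> sD s0 step ut; rewrite leNgt ltrBlDl; apply/negP => /(lt_total_phase sD s0).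
by have := step t; lra.
Qed.

Lemma level_gap_strict s lam t u : all in_disk s ->
  (forall v, total_phase s (v + lam) - total_phase s v < pi) ->
  pi <= total_phase s u - total_phase s t -> lam < u - t.
Proof.
move=> sD step ut; rewrite ltNge lerBlDl; apply/negP => /(le_total_phase sD).
by have := step t; lra.
Qed.

Lemma step_Tclosed n F s zeta lam : (0 < n)%N -> 0 < lam ->
  zeros_of F s -> size F = n.+1 -> all in_disk s -> `|zeta| = 1 ->
  (forall t, total_phase s (t + lam) - total_phase s t <= pi) ->
  Tclosed n lam (F + zeta *: ninv n F).
Proof.
move=> n0 lam0 h sF sD z1 step.
have F0 : F != 0 by rewrite -size_poly_gt0 sF.
have s0 : s != [::].
  by apply: contraTneq n0 => s0; have := size_zeros F0 h; rewrite sF s0 => -[->].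
have [T [gap sG hG]] := combination_zeros n0 h sF sD z1.
split; first exact: polys_in_circle hG.
exists [seq expi (T k) | k <- iota 0 n] => //; apply: pairwise_iota => j k /gap[].
move=> /(level_gap sD s0 step) g1 /(level_gap sD s0 step) g2; clear z1.
by apply: angle_ge; rewrite ?ger0_norm; lra.
Qed.

Lemma step_Topen n F s zeta lam : (0 < n)%N -> 0 < lam ->
  zeros_of F s -> size F = n.+1 -> all in_disk s -> `|zeta| = 1 ->
  (forall t, total_phase s (t + lam) - total_phase s t < pi) ->
  Topen n lam (F + zeta *: ninv n F).
Proof.
move=> n0 lam0 h sF sD z1 step.
have [T [gap sG hG]] := combination_zeros n0 h sF sD z1.
split; first exact: polys_in_circle hG.
exists [seq expi (T k) | k <- iota 0 n] => //; apply: pairwise_iota => j k /gap[].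
move=> /(level_gap_strict sD step) g1 /(level_gap_strict sD step) g2; clear z1.
by apply: angle_gt; rewrite ?ger0_norm; lra.
Qed.

End Separation.

(** * Separated zeros and the exterior of the disk *)

Section OutsideTheDisk.
Context {R : realType}.
Implicit Types (t u lam : R) (z : R[i]) (P : {poly R[i]}).

Lemma polar z : z != 0 -> exists rho t, [/\ 0 < rho, `|z| = rho%:C & z = rho%:C * expi t].
Proof.
move=> z0; have nz : `|z| = (complex.Re `|z|)%:C by rewrite normc_def.
have r0 : 0 < complex.Re `|z| by rewrite -ltr0C -nz normr_gt0.
have [|t _ ht] := @unit_expi R (z / `|z|).
  by rewrite normrM normfV normr_id divff ?normr_eq0.
exists (complex.Re `|z|), t; split => //.
by rewrite -ht -nz mulrC divfK ?normr_eq0.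
Qed.

Lemma outside_polar z : ~ closed_disk z ->
  exists rho t, 1 < rho /\ z = rho%:C * expi t.
Proof.
move=> hz; have [z0|z0] := eqVneq z 0.
  by case: hz; rewrite /closed_disk /= z0 normr0 ler01.
have [rho [t [r0 nz e]]] := polar z0; exists rho, t; split => //.
by rewrite ltNge; apply/negP => r1; apply: hz; rewrite /closed_disk /= nz lecR.
Qed.

(** The sum telescopes, apart from the increases over the gaps between
    consecutive steps, which are missing.  The equality case is what makes the
    final bound on the argument strict. *)
Lemma sum_disjoint_steps (B : R -> R) lam x0 xs :
  {homo B : t u / t < u} -> path (fun x y => x + lam <= y) x0 xs ->
  \sum_(x <- x0 :: xs) (B (x + lam) - B x) <= B (last x0 xs + lam) - B x0 /\
  (\sum_(x <- x0 :: xs) (B (x + lam) - B x) = B (last x0 xs + lam) - B x0 ->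
   last x0 xs + lam - x0 = (size xs).+1%:R * lam).
Proof.
move=> incB; elim: xs x0 => [|y xs IH] x0 /=.
  by move=> _; rewrite big_seq1; split => // _; rewrite mul1r addrAC subrr add0r.
move=> /andP[xy /IH]; rewrite big_cons; set S := \sum_(_ <- _) _ => -[le_S eq_S].
have [Bxy|] := ltP (B (x0 + lam)) (B y); first by split; lra.
rewrite leNgt => nB; have {}xy : x0 + lam = y.
  by apply/eqP; rewrite eq_le xy leNgt; apply: contra nB => /incB.
rewrite xy; split; first lra.
move=> e; have {}eq_S := eq_S _; rewrite -natr1 mulrDl mul1r -eq_S; lra.
Qed.

Lemma angle_gap lam t u : t <= u <= t + 2 * pi -> lam <= angle (expi t) (expi u) ->
  t + lam <= u /\ u <= t + (2 * pi - lam).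
Proof.
move=> tu; have d : `|u - t| = u - t by rewrite ger0_norm; lra.
rewrite angle_expi_min d; last lra.
by rewrite le_min; lra.
Qed.

(** For a polynomial with separated zeros on the circle, the argument of the
    quotient at [z] is the phase gained over disjoint arcs of length [lam]
    around the zeros: positive, and less than [pi] because the arcs do not
    fill the circle.  (Divided by [pi], it is the harmonic measure at [z] of
    the union of the arcs.) *)
Lemma Tclosed_Dclosed n lam P : (0 < n)%N -> 0 < lam < 2 * pi / n%:R ->
  Tclosed n lam P -> Dclosed n lam P.
Proof.
move=> n0 /andP[lam0 lam1] [[sP hP] [s hs sep]]; split => // z /outside_polar [rho [u [r1 ->]]].
have P0 : P != 0 by rewrite -size_poly_gt0 sP.
have sn : size s = n by have := size_zeros P0 hs; rewrite sP => -[].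
have nlam : n%:R * lam < 2 * pi by rewrite mulrC -ltr_pdivlMr ?ltr0n.
have r0 : 0 < rho by lra.
have p0 := pi_gt0 R.
have circ a : a \in s -> `|a| = 1.
  by move=> as_; apply: hP; move: as_; rewrite -(root_zeros P0 hs).
have [ts ets tsb] : exists2 ts, s = [seq expi t | t <- ts] & all (fun t => - pi <= t <= pi) ts.
  elim: (s) circ => [|a s' IH] circ; first by exists [::].
  have [|ts -> hts] := IH; first by move=> b bs; apply: circ; rewrite in_cons bs orbT.
  have [t ht ->] := unit_expi (circ _ (mem_head _ _)).
  by exists (t :: ts) => //=; rewrite ht.
(* By rotation invariance, the zero [expi t] contributes the gain of the
   single function [B] over the step that starts at [f t]. *)
pose f t := u - lam / 2 - t; pose B := phase (rho^-1)%:C.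
have rD : in_disk (rho^-1)%:C.
  rewrite /in_disk (_ : 1 = 1%:C) // norm_lt_real ltr01 /= expr0n addr0 expr1n.
  by rewrite expr_lt1 ?invr_ge0 ?ltW // invf_lt1.
have sD : all in_disk [seq a / rho%:C | a <- s].
  apply/allP => _ /mapP[a /circ a1 ->]; rewrite /in_disk norm_div_lt1 // a1.
  by rewrite (_ : 1 = 1%:C) // ltcR.
have [m m0 ->] := quot_total_phase lam u hs sP r0 sD; rewrite Im_scale pmulr_rgt0 //=.
have -> : total_phase [seq a / rho%:C | a <- s] (u + lam / 2) -
    total_phase [seq a / rho%:C | a <- s] (u - lam / 2) =
    \sum_(x <- map f ts) (B (x + lam) - B x).
  rewrite /total_phase ets !big_map -sumrB; apply: eq_bigr => t _.
  rewrite mulrC -fmorphV !phase_rotation -/B /f; set b := B _; set b' := B _.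
  have -> : u - lam / 2 - t + lam = u + lam / 2 - t by lra.
  by rewrite -/b opprD addrACA subrr add0r.
have sepx : pairwise (fun x y => lam <= angle (expi x) (expi y)) (map f ts).
  rewrite ets pairwise_map in sep; rewrite pairwise_map; apply: sub_pairwise sep => t v /=.
  by rewrite !angleE !conj_expi -!expiD /= -(cosN (t - v)) /f; congr (_ <= acos (cos _)); lra.
have : perm_eq (map f ts) (sort <=%R (map f ts)) by rewrite perm_sym perm_sort.
move=> /[dup] /(perm_big _) -> /= pm.
have {}sepx := perm_pairwise (fun x y => congr1 (fun d => lam <= d) (angleC _ _)) pm sepx.
have : pairwise <=%R (sort <=%R (map f ts)).
  by rewrite -(sorted_pairwise le_trans) sort_le_sorted.
have : {in sort <=%R (map f ts) &, forall x y, y <= x + 2 * pi}.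
  move=> x y; rewrite !mem_sort => /mapP[t /(allP tsb) ht ->] /mapP[v /(allP tsb) hv ->].
  by rewrite /f; lra.
have : size (sort <=%R (map f ts)) = n by rewrite size_sort size_map -sn ets size_map.
case: (sort _ _) sepx => [|x0 xs]; first by move=> _ n00; move: n0; rewrite -n00.
move=> sepx sxs near srt.
have : pairwise (fun x y => (x + lam <= y) && (y <= x + (2 * pi - lam))) (x0 :: xs).
  have : pairwise [rel x y | (x <= y) && (lam <= angle (expi x) (expi y))] (x0 :: xs).
    by rewrite pairwise_relI srt.
  apply: (@sub_in_pairwise _ (mem (x0 :: xs))); last by apply/allP.
  move=> x y xin yin /andP[xy sxy]; apply/andP; apply: angle_gap => //.
  by rewrite xy near.
move=> /= /andP[allx pwx].
have gaps : path (fun x y => x + lam <= y) x0 xs.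
  apply: (@sub_path _ (fun x y => (x + lam <= y) && (y <= x + (2 * pi - lam)))).
    by move=> x y /andP[].
  by rewrite -/(sorted _ (x0 :: xs)); apply: pairwise_sorted; rewrite /= allx.
have lastx : last x0 xs + lam <= x0 + 2 * pi.
  case/lastP: (xs) sxs allx => [/= n1 _|ys y _].
    by move: nlam; rewrite -n1 mul1r; lra.
  by rewrite last_rcons all_rcons => /andP[/andP[_ h] _]; lra.
have incB : {homo B : t u / t < u} by exact: lt_phase.
have [le_S eq_S] := sum_disjoint_steps incB gaps.
set S := \sum_(_ <- _) _ in le_S eq_S *.
have le_B : B (last x0 xs + lam) - B x0 <= pi.
  rewrite lerBlDl -phaseD2pi; move: lastx; rewrite le_eqVlt.
  by move=> /predU1P[->|/incB/ltW].
apply: sin_gt0_pi; apply/andP; split.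
  have step x : 0 < B (x + lam) - B x by rewrite subr_gt0; apply: incB; lra.
  rewrite /S big_cons; apply: ltr_wpDr => //.
  by apply: sumr_ge0 => x _; exact: ltW.
(* A gain of exactly [pi] would mean that the [n] arcs of length [lam] leave
   no gap, that is, [n * lam = 2 * pi]. *)
rewrite lt_neqAle (le_trans le_S le_B) andbT; apply/eqP => Spi.
have e : S = B (last x0 xs + lam) - B x0 by lra.
have := eq_S e; rewrite [(size xs).+1]sxs => e'.
have : B (last x0 xs + lam) < B (x0 + 2 * pi) by apply: incB; lra.
by rewrite [B (x0 + _)]phaseD2pi -/B; lra.
Qed.

End OutsideTheDisk.

(** * What the combinations say about [F] *)

Section FromCombinations.
Context {R : realType}.
Implicit Types (lam : R) (z a : R[i]) (s : seq R[i]) (F P Q : {poly R[i]}).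

(** Separation by a positive angle excludes multiple zeros. *)
Lemma Tclosed_simple n lam z P Q : 0 < lam -> Tclosed n lam P ->
  P = ('X - z%:P) * Q -> Q.[z] != 0.
Proof.
move=> lam0 [[sP hP] [s hs sep]] e; apply/eqP => Qz.
have P0 : P != 0 by rewrite -size_poly_gt0 sP.
have l0 : lead_coef P != 0 by rewrite lead_coef_eq0.
have rz : root P z by rewrite e rootM root_XsubC eqxx.
have zs : z \in s by rewrite -(root_zeros P0 hs).
have pz := perm_to_rem zs.
have {}sep := perm_pairwise (fun x y => congr1 (fun d => lam <= d) (angleC _ _)) pz sep.
have : z \in rem z s.
  rewrite -root_prod_XsubC; have := e; rewrite hs (perm_big _ pz) big_cons /=.
  rewrite scalerAr => /mulfI; rewrite polyXsubC_eq0 => /(_ isT) eQ.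
  by rewrite -(rootZ _ _ l0) eQ /root Qz.
move: sep => /= /andP[/allP h _] /h; have [t _ ->] := unit_expi (hP _ rz).
rewrite angleE conj_expi -expiD subrr expi0 acos1; lra.
Qed.

Lemma size_mulXsubC a Q n : size (('X - a%:P) * Q) = n.+2 -> size Q = n.+1.
Proof.
move=> sz; have Q0 : Q != 0 by apply: contra_eq_neq sz => ->; rewrite mulr0 size_poly0.
by move: sz; rewrite size_monicM ?monicXsubC // size_XsubC /= => -[].
Qed.

Lemma ninv_mulXsubC n a Q : (size Q <= n.+1)%N ->
  ninv n.+1 (('X - a%:P) * Q) = (1 - conjc a *: 'X) * ninv n Q.
Proof.
move=> sQ; apply/polyP => k; rewrite [(1 - _) * _]mulrBl mul1r -scalerAl coefB coefZ coefXM.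
rewrite /ninv !coef_poly mulrBl coefB coefXM coefCM conjcB conjcM.
have Qn : Q`_n.+1 = 0 by rewrite nth_default.
case: k => [|k]; first by rewrite !subn0 /= Qn !mulr0 conjc0 mulr0.
rewrite /= subSS !ltnS; case: (ltngtP k n) => [kn|nk|->].
- by rewrite subn_eq0 leqNgt kn /= subnS.
- by rewrite mulr0 subrr.
- by rewrite subnn eqxx conjc0.
Qed.

(** At a common zero on the circle the cofactors of [F] and of its [n]-inverse
    have the same modulus, so that some combination of them vanishes too. *)
Lemma double_zero_combination n F z : size F = n.+1 -> root F z -> `|z| = 1 ->
  exists zeta Q, [/\ `|zeta| = 1, F + zeta *: ninv n F = ('X - z%:P) * Q & Q.[z] = 0].
Proof.
move=> sF /factor_theorem [Q']; rewrite mulrC => e z1.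
case: n sF => [|n] sF.
  have F0 : F != 0 by rewrite -size_poly_gt0 sF.
  move: sF F0; rewrite e => sF F0; have Q0 : Q' != 0 by apply: contraNneq F0 => ->; rewrite mulr0.
  move: sF; rewrite size_monicM ?monicXsubC // size_XsubC /= => /eqP.
  by rewrite eqSS size_poly_eq0 (negbTE Q0).
have sQ : size Q' = n.+1 by apply: (@size_mulXsubC z); rewrite -e.
have z0 : z != 0 by rewrite -normr_eq0 z1 oner_eq0.
have eN : ninv n.+1 F = ('X - z%:P) * (- z^-1 *: ninv n Q').
  rewrite e ninv_mulXsubC ?sQ // (conjc_norm1 z1) -scalerAr scalerAl; congr (_ * _).
  by rewrite scalerBr !scaleNr opprK -[z%:P]alg_polyC scalerA mulVf // scale1r addrC.
pose k := z^-1 * z ^+ n.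
have Nz : (- z^-1 *: ninv n Q').[z] = - (k * conjc Q'.[z]).
  by rewrite hornerZ horner_ninv_circle ?sQ // mulNr mulrA.
have k1 : `|k| = 1 by rewrite normrM normfV normrX z1 expr1n invr1 mulr1.
have k0 : k != 0 by rewrite -normr_eq0 k1 oner_eq0.
have [Q0|Q0] := eqVneq Q'.[z] 0.
  exists 1, (Q' + - z^-1 *: ninv n Q'); split; first exact: normr1.
    by rewrite scale1r eN {1}e mulrDr.
  by rewrite hornerD Nz Q0 conjc0 mulr0 oppr0 addr0.
have cQ0 : conjc Q'.[z] != 0 by rewrite conjc_eq0.
exists (Q'.[z] / (k * conjc Q'.[z])),
  (Q' + (Q'.[z] / (k * conjc Q'.[z])) *: (- z^-1 *: ninv n Q')).
split; first by rewrite normrM normfV normrM k1 mul1r normcJ divff // normr_eq0.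
  by rewrite eN {1}e mulrDr scalerAr.
by rewrite hornerD [X in _ + X]hornerZ Nz mulrN divfK ?subrr // mulf_neq0.
Qed.

Lemma combinations_in_disk n F lam s : 0 < lam -> polys_in n (@closed_disk R) F ->
  (forall zeta, `|zeta| = 1 -> Tclosed n lam (F + zeta *: ninv n F)) ->
  zeros_of F s -> all in_disk s.
Proof.
move=> lam0 [sF hF] hT hs; have F0 : F != 0 by rewrite -size_poly_gt0 sF.
apply/allP => a; rewrite -(root_zeros F0 hs) => ra.
have := hF _ ra; rewrite /closed_disk /in_disk /= le_eqVlt => /predU1P[a1|//].
have [zeta [Q [z1 e Qa]]] := double_zero_combination sF ra a1.
by have := Tclosed_simple lam0 (hT _ z1) e; rewrite Qa eqxx.
Qed.

(** The image of the centre is a weighted mean of the images of the two ends of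
    the diameter through the pole, so it stays in the half plane that contains
    the image of the circle. *)
Lemma moebius_center (a b c d : R[i]) : c != 0 -> `|d| <= `|c| ->
  (forall zeta, `|zeta| = 1 -> 0 < complex.Im ((a + zeta * b) / (c + zeta * d))) ->
  0 < complex.Im (a / c).
Proof.
move=> c0 dc hIm.
(* [u] and [- u] are the ends of the diameter through the pole [- c / d], or of
   any diameter if there is no pole. *)
have [u [r [u1 r0 e]]] : exists (u : R[i]) (r : R),
    [/\ `|u| = 1, 0 <= r & u * d = (r%:C * c)%R].
  have [->|d0] := eqVneq d 0.
    by exists 1, 0; rewrite normr1 mulr0 mul0r.
  have dc0 : d / c != 0 by rewrite mulf_neq0 ?invr_eq0.
  have [rho [t [r0 _ ht]]] := polar dc0.
  exists (expi (- t)), rho; split; [exact: norm_expi|exact: ltW|].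
  have -> : d = rho%:C * expi t * c by rewrite -ht divfK.
  by rewrite expiN; field; exact: expi_neq0.
have r1 : r <= 1.
  have : `|r%:C * c| <= `|c| by rewrite -e normrM u1 mul1r.
  rewrite normrM ger_pMl ?normr_gt0 // ger0_norm ?ler0c // (_ : 1 = 1%:C) //.
  by rewrite lecR.
have := hIm u u1; have := hIm (- u); rewrite normrN => /(_ u1).
(* The pole is not on the circle, since the quotient would have value [0]
   there. *)
rewrite !mulNr e; have [->|rn1] := eqVneq r 1.
  by rewrite mul1r subrr invr0 mulr0 /= ltxx.
have [r1c r1c'] : 1 + r%:C != 0 /\ 1 - r%:C != 0.
  by split; rewrite eq_complex /= negb_and; apply/orP; left;
    [rewrite gt_eqF // ltr_pwDl|rewrite subr_eq0 eq_sym].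
set m := _ / (c - _); set k := _ / (c + _) => hm hk.
have : (1 - r)%:C * m + (1 + r)%:C * k = 2%:R%:C * (a / c).
  rewrite rmorphB rmorphD /= rmorph1 /m /k (_ : 2%:R%:C = 2); last first.
    by rewrite rmorph_nat.
  have -> : c - r%:C * c = (1 - r%:C) * c by ring.
  have -> : c + r%:C * c = (1 + r%:C) * c by ring.
  by field; rewrite c0 r1c r1c'.
move=> /(congr1 (@complex.Im R)); rewrite ImD !Im_scale.
move: (complex.Im m) (complex.Im k) (complex.Im (a / c)) hm hk => x y w.
by clear -r0 r1 rn1; nra.
Qed.

Lemma combinations_Dclosed n F lam : (0 < n)%N -> 0 < lam < 2 * pi / n%:R ->
  polys_in n (@closed_disk R) F ->
  (forall zeta, `|zeta| = 1 -> Tclosed n lam (F + zeta *: ninv n F)) ->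
  Dclosed n lam F.
Proof.
move=> n0 hlam [sF hF] hT; split => // z hz.
have [rho [t [r1 ez]]] := outside_polar hz.
have z1 : 1 < `|z|.
  rewrite ez normrM norm_expi mulr1 gtr0_norm ?ltr0C; last lra.
  by rewrite (_ : 1 = 1%:C) // ltcR.
have outN v : `|expi v * z| = `|z| by rewrite normrM norm_expi mul1r.
rewrite /quot horner_Fplus horner_Fminus mulrA.
set w := expi (- (lam / 2)) * z; set w' := expi (lam / 2) * z.
apply: (moebius_center
  (b := expi (- (n%:R * lam / 2)) * (ninv n F).[w']) (d := (ninv n F).[w])).
- by apply/negP => /hF; rewrite /closed_disk /= outN lt_geF.
- by apply: norm_ninv_le => //; rewrite outN.
move=> zeta zeta1; have [_ /(_ z hz)] := Tclosed_Dclosed n0 hlam (hT _ zeta1).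
rewrite /quot horner_Fplus horner_Fminus -/w -/w' !hornerD !hornerZ [_ * (_ / _)]mulrA.
by rewrite mulrDr mulrCA.
Qed.

End FromCombinations.

(** * What the quotient says about the zeros of [F] *)

Lemma pairwise_perm (T : eqType) (e : rel T) (s : seq T) :
  (forall x y q, perm_eq s [:: x, y & q] -> e x y) -> pairwise e s.
Proof.
elim: s => //= x s IH h; apply/andP; split.
  by apply/allP => y ys; apply: h; rewrite perm_cons; exact: perm_to_rem.
apply: IH => y y' q; rewrite -(perm_cons x) => /perm_trans yq.
apply: (h y y' (x :: q)); apply: yq.
by rewrite -[[:: x, y, y' & q]]/([:: x] ++ [:: y; y'] ++ q) perm_catCA.
Qed.

Section ToCombinations.
Context {R : realType}.
Implicit Types (t rho r lam : R) (a : R[i]) (s p q : seq R[i]) (F : {poly R[i]}).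

Lemma Im_quot_sin n lam F s rho t : zeros_of F s -> size F = n.+1 -> 0 < rho ->
  let s' := [seq a / rho%:C | a <- s] in all in_disk s' ->
  (0 < complex.Im (quot n lam F (rho%:C * expi (t + lam / 2)))) =
  (0 < sin (total_phase s' (t + lam) - total_phase s' t)).
Proof.
move=> h sF r0 s' sD; have [m m0 ->] := quot_total_phase lam (t + lam / 2) h sF r0 sD.
rewrite Im_scale pmulr_rgt0 //= addrK -/s' -addrA.
by rewrite -splitr.
Qed.

Lemma step_lt_2pi n lam : (0 < n)%N -> 0 < lam < 2 * pi / n%:R -> lam < 2 * pi.
Proof.
move=> n0 /andP[lam0]; rewrite ltr_pdivlMr ?ltr0n // => h.
have : 1 <= n%:R :> R by rewrite ler1n.
nra.
Qed.

(** On the circle of radius [r^-1] the polynomial looks as if its zeros were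
    shrunk by [r] into the open disk, where the phase is continuous. *)
Lemma Dclosed_shrunk_step n lam F s r t : (0 < n)%N -> 0 < lam < 2 * pi / n%:R ->
  polys_in n (@closed_disk R) F -> zeros_of F s -> Dclosed n lam F -> 0 < r < 1 ->
  total_phase [seq r%:C * a | a <- s] (t + lam) - total_phase [seq r%:C * a | a <- s] t <= pi.
Proof.
move=> n0 hlam [sF hF] h [_ hD] /andP[r0 r1].
have F0 : F != 0 by rewrite -size_poly_gt0 sF.
have sn : size s = n by have := size_zeros F0 h; rewrite sF => -[].
have ri0 : 0 < r^-1 by rewrite invr_gt0.
have ri1 : 1 < r^-1 by rewrite invf_gt1.
have es : [seq r%:C * a | a <- s] = [seq a / (r^-1)%:C | a <- s].
  by apply: eq_map => a; rewrite fmorphV invrK mulrC.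
have sD : all in_disk [seq a / (r^-1)%:C | a <- s].
  apply/allP => _ /mapP[a as_ ->]; rewrite /in_disk norm_div_lt1 //.
  apply: (@le_lt_trans _ _ (1 : R)%:C); last by rewrite ltcR.
  by apply: hF; move: as_; rewrite -(root_zeros F0 h).
rewrite es; apply: total_phase_step_le_pi => //.
- by rewrite -size_eq0 size_map sn -lt0n.
- by rewrite size_map sn.
move=> v; apply/ltW; rewrite -(Im_quot_sin _ _ h sF ri0 sD); apply: hD.
rewrite /closed_disk /= normrM norm_expi mulr1 gtr0_norm ?ltr0C //.
by rewrite (_ : 1 = 1%:C) // lecR; apply/negP; rewrite -ltNge.
Qed.

(** Letting the zeros return from the open disk to their places: each group
    of zeros gains at most [pi] over a step. *)
Lemma Dclosed_step n lam F s p q t : (0 < n)%N -> 0 < lam < 2 * pi / n%:R ->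
  polys_in n (@closed_disk R) F -> zeros_of F s -> Dclosed n lam F ->
  perm_eq s (p ++ q) ->
  all (fun a => facing a t) p -> all (fun a => facing a (t + lam)) p ->
  total_phase p (t + lam) - total_phase p t <= pi.
Proof.
move=> n0 hlam hF h hD spq pt pt'.
have /andP[lam0 _] := hlam.
pose f r := total_phase [seq r%:C * a | a <- p] (t + lam) -
  total_phase [seq r%:C * a | a <- p] t.
have cf : f @ (1 : R)^'- --> total_phase p (t + lam) - total_phase p t.
  by apply: cvg_at_left_filter; apply: cvgB; exact: cvg_total_phase_shrink.
apply: (cvgr_to_le cf); near=> r.
have r01 : 0 < r < 1 by apply/andP; split; near: r; [exact: nbhs_left_gt|exact: nbhs_left_lt].
apply: le_trans (Dclosed_shrunk_step t n0 hlam hF h hD r01).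
have pe : perm_eq [seq r%:C * a | a <- s] ([seq r%:C * a | a <- p] ++ [seq r%:C * a | a <- q]).
  by rewrite -map_cat perm_map.
rewrite /f /total_phase !(perm_big _ pe) !big_cat /= opprD addrACA lerDl subr_ge0.
apply: le_total_phase; last by rewrite lerDl ltW.
apply/allP => _ /mapP[a aq ->]; case: hF => sF hF.
have F0 : F != 0 by rewrite -size_poly_gt0 sF.
have a1 : `|a| <= 1.
  apply: hF; rewrite -[root F a]/(a \in root F) (root_zeros F0 h).
  by rewrite (perm_mem spq) mem_cat aq orbT.
case/andP: r01 => r0 r1; rewrite /in_disk normrM gtr0_norm ?ltr0C //.
apply: (@le_lt_trans _ _ r%:C); last by rewrite (_ : 1 = 1%:C) // ltcR.
by rewrite ger_pMr ?ltr0C.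
Unshelve. all: by end_near.
Qed.

(** A zero [a] on the circle already contributes a jump of [pi] to every step
    across it.  Hence no other zero may contribute: it must lie on the circle
    too, too far from [a] for one step to cross both. *)
Lemma Dclosed_circle_pair n lam F s q a b : (0 < n)%N -> 0 < lam < 2 * pi / n%:R ->
  polys_in n (@closed_disk R) F -> zeros_of F s -> Dclosed n lam F ->
  perm_eq s [:: a, b & q] -> `|a| = 1 -> `|b| = 1 /\ lam <= angle a b.
Proof.
move=> n0 hlam hF h hD spq a1.
have lam2 := step_lt_2pi n0 hlam; have /andP[lam0 _] := hlam.
have step t := Dclosed_step (t := t) (p := [:: a; b]) (q := q) n0 hlam hF h hD spq.
have b1 : `|b| <= 1.
  case: hF => sF hF; have F0 : F != 0 by rewrite -size_poly_gt0 sF.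
  apply: hF; rewrite -[root F b]/(b \in root F) (root_zeros F0 h).
  by rewrite (perm_mem spq) !inE eqxx orbT.
clear hF h hD spq; have [al _ ea] := unit_expi a1.
have p0 := pi_gt0 R.
have two t : total_phase [:: a; b] t = phase a t + phase b t.
  by rewrite !total_phase_cons total_phase_nil addr0.
have fac be t : 0 < `|be - t| < 2 * pi -> facing (expi be) t.
  by move=> hd; apply: facing_closed_disk; [rewrite norm_expi|exact: expi_neq].
move: b1; rewrite le_eqVlt => /predU1P[b1|b1]; last first.
  have fb v : facing b v := facing_disk v b1.
  have inc := @lt_phase R b b1; clear a1 b1; exfalso; pose t := al - lam / 2.
  have ja : phase a (t + lam) - phase a t = pi by rewrite ea; apply: phase_jump; rewrite /t; lra.
  have jb : phase b t < phase b (t + lam) by apply: inc; lra.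
  have := step t; rewrite /= !fb ea !fac /t; last 2 first.
  - by rewrite ltr0_norm; lra.
  - by rewrite gtr0_norm; lra.
  by rewrite -/t -ea !two => /(_ isT isT); lra.
split=> //; rewrite leNgt; apply/negP => ab.
have [be dbe eb] := lift_angle al b1; rewrite -ea in dbe; rewrite -dbe in ab.
have /andP[ab1 ab2] : - lam < be - al < lam by rewrite -ltr_norml.
clear a1 b1; pose t := (al + be) / 2 - lam / 2.
have ja : phase a (t + lam) - phase a t = pi by rewrite ea; apply: phase_jump; rewrite /t; lra.
have jb : phase b (t + lam) - phase b t = pi by rewrite eb; apply: phase_jump; rewrite /t; lra.
have := step t; rewrite /= ea eb !fac /t; last 4 first.
- by rewrite ltr0_norm; lra.
- by rewrite ltr0_norm; lra.
- by rewrite gtr0_norm; lra.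
- by rewrite gtr0_norm; lra.
by rewrite -/t -ea -eb !two => /(_ isT isT); lra.
Qed.

Lemma Dclosed_circle_Tclosed n lam F s a : (0 < n)%N -> 0 < lam < 2 * pi / n%:R ->
  polys_in n (@closed_disk R) F -> zeros_of F s -> Dclosed n lam F ->
  a \in s -> `|a| = 1 -> Tclosed n lam F.
Proof.
move=> n0 hlam hF h hD as_ a1; have [sF _] := hF.
have F0 : F != 0 by rewrite -size_poly_gt0 sF.
have circ b : b \in s -> `|b| = 1.
  rewrite (perm_mem (perm_to_rem as_)) inE => /predU1P[->//|/perm_to_rem bs].
  have pe : perm_eq s [:: a, b & rem b (rem a s)].
    by rewrite (permPl (perm_to_rem as_)) perm_cons.
  by have [] := Dclosed_circle_pair n0 hlam hF h hD pe a1.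
split; first by split => // b rb; apply: circ; rewrite -(root_zeros F0 h).
exists s => //; apply: pairwise_perm => x y q pe.
have x1 : `|x| = 1 by apply: circ; rewrite (perm_mem pe) mem_head.
by have [] := Dclosed_circle_pair n0 hlam hF h hD pe x1.
Qed.

Lemma Dclosed_not_Tclosed n lam F s : (0 < n)%N -> 0 < lam < 2 * pi / n%:R ->
  polys_in n (@closed_disk R) F -> zeros_of F s -> (Dclosed n lam `\` Tclosed n lam) F ->
  all in_disk s /\ forall t, total_phase s (t + lam) - total_phase s t <= pi.
Proof.
move=> n0 hlam hF h [hD hT]; have [sF hF'] := hF.
have F0 : F != 0 by rewrite -size_poly_gt0 sF.
have sD : all in_disk s.
  apply/allP => a as_; have : `|a| <= 1 by apply: hF'; move: as_; rewrite -(root_zeros F0 h).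
  rewrite le_eqVlt => /predU1P[a1|//]; case: hT.
  exact: Dclosed_circle_Tclosed hF h hD as_ a1.
split=> // t; apply: (Dclosed_step (q := [::]) n0 hlam hF h hD).
- by rewrite cats0.
- by apply: sub_all sD => a; exact: facing_disk.
- by apply: sub_all sD => a; exact: facing_disk.
Qed.

End ToCombinations.

(** * Nonnegative polynomials on the circle *)

Section DoubleRootOnCircle.
Context {R : realType}.
Implicit Types (u v : R) (P Q : {poly R[i]}).

(* Continuity of the two coordinates is all that is needed here, so the
   topology of the complex numbers is avoided. *)
Let cts (f : R -> R[i]) :=
  continuous (fun u => complex.Re (f u)) /\ continuous (fun u => complex.Im (f u)).

Lemma cts_mul (f g : R -> R[i]) : cts f -> cts g -> cts (fun u => f u * g u).
Proof.
move=> [fr fi] [gr gi]; split => u.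
  have -> : (fun v => complex.Re (f v * g v)) = (fun v => complex.Re (f v) * complex.Re (g v)
     - complex.Im (f v) * complex.Im (g v)).
    by apply/funext => v; case: (f v); case: (g v).
  by apply: cvgB; apply: cvgM; [exact: fr|exact: gr|exact: fi|exact: gi].
have -> : (fun v => complex.Im (f v * g v)) = (fun v => complex.Re (f v) * complex.Im (g v)
     + complex.Im (f v) * complex.Re (g v)).
  by apply/funext => v; case: (f v); case: (g v).
by apply: cvgD; apply: cvgM; [exact: fr|exact: gi|exact: fi|exact: gr].
Qed.

Lemma cts_expi (f : R -> R) : continuous f -> cts (fun u => expi (f u)).
Proof.
move=> cf; split=> u /=.
  by apply: (@continuous_comp _ _ _ f (@cos R)); [exact: cf|exact: continuous_cos].
by apply: (@continuous_comp _ _ _ f (@sin R)); [exact: cf|exact: continuous_sin].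
Qed.

Lemma cts_horner_expi P : cts (fun u => P.[expi u]).
Proof.
elim/poly_ind: P => [|P a [cr ci]].
  have -> : (fun u => (0 : {poly R[i]}).[expi u]) = (fun=> 0).
    by apply/funext => u; rewrite horner0.
  by split=> u; exact: cvg_cst.
have [mr mi] := cts_mul (conj cr ci) (cts_expi (fun u : R => @cvg_id _ (nbhs u))).
have -> : (fun u => (P * 'X + a%:P).[expi u]) = (fun u => P.[expi u] * expi u + a).
  by apply/funext => u; rewrite hornerMXaddC.
split.
  have -> : (fun u => complex.Re (P.[expi u] * expi u + a)) =
      (fun u => complex.Re (P.[expi u] * expi u) + complex.Re a).
    by apply/funext => u; rewrite ReD.
  by move=> u; apply: cvgD; [exact: mr|exact: cvg_cst].
have -> : (fun u => complex.Im (P.[expi u] * expi u + a)) =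
    (fun u => complex.Im (P.[expi u] * expi u) + complex.Im a).
  by apply/funext => u; rewrite ImD.
by move=> u; apply: cvgD; [exact: mi|exact: cvg_cst].
Qed.

(** The sine changes sign at [u0], so a continuous factor that keeps the
    product nonnegative vanishes there. *)
Lemma sin_sign_change (f : R -> R) u0 : {for u0, continuous f} ->
  (forall u, 0 <= sin ((u - u0) / 2) * f u) -> f u0 = 0.
Proof.
move=> cf hf; have p0 := pi_gt0 R; apply/eqP; rewrite eq_le; apply/andP; split.
  have cl : f @ u0^'- --> f u0 by apply: cvg_at_left_filter; exact: cf.
  apply: (cvgr_to_le cl); near=> u.
  have h1 : u0 - pi < u by near: u; apply: nbhs_left_gt; lra.
  have h2 : u < u0 by near: u; exact: nbhs_left_lt.
  have : 0 < sin ((u0 - u) / 2) by apply: sin_gt0_pi; lra.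
  have := hf u; rewrite (_ : (u - u0) / 2 = - ((u0 - u) / 2)); last lra.
  by rewrite sinN; nra.
have cr : f @ u0^'+ --> f u0 by apply: cvg_at_right_filter; exact: cf.
apply: (cvgr_to_ge cr); near=> u.
have h1 : u < u0 + pi by near: u; apply: nbhs_right_lt; lra.
have h2 : u0 < u by near: u; exact: nbhs_right_gt.
have : 0 < sin ((u - u0) / 2) by apply: sin_gt0_pi; lra.
by have := hf u; nra.
Unshelve. all: by end_near.
Qed.

Lemma expi_sub u v : expi u - expi v = expi ((u + v) / 2) * (0 +i* (2 * sin ((u - v) / 2))).
Proof.
have -> : expi u = expi ((u + v) / 2) * expi ((u - v) / 2) by rewrite -expiD; congr expi; lra.
have -> : expi v = expi ((u + v) / 2) * expi (- ((u - v) / 2)) by rewrite -expiD; congr expi; lra.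
rewrite -mulrBr; congr (_ * _); apply/eqP; rewrite eq_complex /= cosN sinN.
by apply/andP; split; apply/eqP; lra.
Qed.

(** Along the circle a simple zero contributes the factor
    [sin ((u - u0) / 2)], hence a sign change. *)
Lemma nonneg_circle_double_root n P Q u0 (k : R -> R) :
  (forall u, 0 <= k u) ->
  (forall u, P.[expi u] = expi (n%:R * u) * (0 +i* k u)) ->
  P = ('X - (expi u0)%:P) * Q -> Q.[expi u0] = 0.
Proof.
move=> k0 hP e; pose g u := expi ((u + u0) / 2 - n%:R * u) * Q.[expi u].
have hg u : (2 * sin ((u - u0) / 2))%:C * g u = (k u)%:C.
  have imag (x : R) : 0 +i* x = 'i%C * x%:C :> R[i].
    by apply/eqP; rewrite eq_complex /=; apply/andP; split; apply/eqP; ring.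
  have := hP u; rewrite e hornerM hornerXsubC expi_sub (imag (2 * _)) (imag (k u)).
  have cancel_i (p h x q y i : R[i]) : p != 0 -> i * i = -1 ->
      h * (i * x) * q = p * (i * y) -> x * (h * p^-1 * q) = y.
    move=> p0 ii E; have -> : y = - (i / p) * (p * (i * y)).
      by rewrite mulNr (mulrA (i / p)) divfK // (mulrA i) ii mulN1r opprK.
    rewrite -E; transitivity (- (i * i) * (x * (h * p^-1 * q))); last by field.
    by rewrite ii opprK mul1r.
  move=> /(cancel_i _ _ _ _ _ _ (expi_neq0 _)) E.
  by rewrite /g expiD expiN; apply: E; rewrite -expr2 sqr_i.
have [gr gi] : cts g.
  apply: cts_mul; last exact: cts_horner_expi.
  apply: cts_expi => u; apply: cvgB.
    by apply: cvgMl; apply: cvgD; [exact: cvg_id|exact: cvg_cst].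
  by apply: cvgMr; exact: cvg_id.
have r0 : complex.Re (g u0) = 0.
  apply: (sin_sign_change (gr u0)) => u.
  by have := congr1 (@complex.Re R) (hg u); rewrite Re_scale /=; have := k0 u; lra.
have i0 : complex.Im (g u0) = 0.
  apply: (sin_sign_change (gi u0)) => u.
  by have := congr1 (@complex.Im R) (hg u); rewrite Im_scale /=; lra.
have : g u0 == 0 by rewrite eq_complex r0 i0 /= !eqxx.
by rewrite mulf_eq0 (negbTE (expi_neq0 _)) /= => /eqP.
Qed.

End DoubleRootOnCircle.

(** * Limits of rational functions *)

Section RationalLimit.
Context {K : numFieldType}.
Implicit Types (P Q : {poly K}).

Lemma cvg_horner P (z : K) : (fun w : K => P.[w]) @ z --> P.[z].
Proof.
have FF := nbhs_filter (z : K); elim/poly_ind: P => [|P a IH].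
  have -> : (fun w : K => (0 : {poly K}).[w]) = (fun=> 0).
    by apply/funext => w; rewrite horner0.
  by rewrite horner0; exact: cvg_cst.
have -> : (fun w => (P * 'X + a%:P).[w]) = (fun w => P.[w] * w + a).
  by apply/funext => w; rewrite hornerMXaddC.
by rewrite hornerMXaddC; apply: cvgD; [apply: cvgM|exact: cvg_cst].
Qed.

Lemma cvg_ratio (k z : K) P Q (f : K -> K) : Q.[z] != 0 ->
  (forall w, w != z -> f w = k * (P.[w] / Q.[w])) ->
  f @ z^' --> k * (P.[z] / Q.[z]).
Proof.
move=> Q0 hf; have FF := nbhs_filter (z : K).
have cP : (fun w : K => k * (P.[w] / Q.[w])) @ z --> k * (P.[z] / Q.[z]).
  apply: cvgMr; apply: cvgM; first exact: cvg_horner.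
  by apply: cvgV => //; exact: cvg_horner.
move=> U /cP; apply: (@filterS _ (nbhs z) FF) => w /= Uw wz.
by rewrite hf.
Qed.

End RationalLimit.

(** * The Wronskian of the quotient *)

Section Limit.
Context {R : realType}.
Implicit Types (u lam : R) (zeta : R[i]) (F : {poly R[i]}).

(** Up to the normalising factor, the numerator of the difference of the
    quotients of [F] and of [ninv n F], which take conjugate values on the
    circle.  Being a determinant, it does not change when a multiple of
    [ninv n F] is added to [F]. *)
Definition quot_wronskian n lam F : {poly R[i]} :=
  Fplus lam F * Fminus lam (ninv n F) - Fminus lam F * Fplus lam (ninv n F).

Lemma quot_wronskian_combination n lam F zeta :
  let G := F + zeta *: ninv n F in
  quot_wronskian n lam F =
    Fplus lam G * Fminus lam (ninv n F) - Fminus lam G * Fplus lam (ninv n F).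
Proof.
rewrite /= /quot_wronskian /Fplus /Fminus !comp_polyD !comp_polyZ -!mul_polyC; ring.
Qed.

Lemma quot_wronskian_circle n lam F u : size F = n.+1 ->
  (Fminus lam F).[expi u] != 0 ->
  (quot_wronskian n lam F).[expi u] = expi (n%:R * u) *
    (0 +i* (2 * complex.Re (`|(Fminus lam F).[expi u]| ^+ 2) *
            complex.Im (quot n lam F (expi u)))).
Proof.
move=> sF; rewrite /quot_wronskian hornerD hornerN !hornerM /quot.
rewrite !horner_Fplus !horner_Fminus -!expiD !horner_ninv_circle ?sF ?norm_expi //.
rewrite -!expiM_nat sqr_normc.
set a := F.[expi (lam / 2 + u)]; set c := F.[_] => c0.
have -> : n%:R * (lam / 2 + u) = n%:R * u + n%:R * lam / 2 by field.
have -> : n%:R * (- (lam / 2) + u) = n%:R * u + - (n%:R * lam / 2) by field.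
rewrite !expiD.
have -> : expi (n%:R * lam / 2) = conjc (expi (- (n%:R * lam / 2))).
  by rewrite conj_expi opprK.
move: (expi (n%:R * u)) (expi (- (n%:R * lam / 2))) => p e.
transitivity (p * (e * a * conjc c - conjc (e * a * conjc c))).
  by rewrite !conjcM conjcK; ring.
congr (_ * _).
have -> : 2 * complex.Re (c * conjc c) * complex.Im (e * (a / c)) =
    2 * complex.Im (e * a * conjc c).
  rewrite -mulrA; congr (_ * _).
  rewrite -Im_scale; congr complex.Im.
  have -> : (complex.Re (c * conjc c))%:C = c * conjc c.
    by case: (c) => x y; apply/eqP; rewrite eq_complex /=; apply/andP; split; apply/eqP; ring.
  by field.
by case: (_ * conjc c) => x y; apply/eqP; rewrite eq_complex /=; apply/andP; split; apply/eqP; ring.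
Qed.

End Limit.

(** * The limit and the strict inequalities *)

Section MainLemmas.
Context {R : realType}.
Implicit Types (lam : R) (z zeta : R[i]) (s : seq R[i]) (F G P : {poly R[i]}).

Lemma in_disk_no_circle_root F s z : F != 0 -> zeros_of F s -> all in_disk s ->
  `|z| = 1 -> F.[z] != 0.
Proof.
move=> F0 h /allP sD z1; apply/negP => /eqP/rootP.
by rewrite -[root F z]/(z \in root F) (root_zeros F0 h) => /sD; rewrite /in_disk z1 ltxx.
Qed.

Lemma Fminus_simple_root n lam G z : 0 < lam -> Tclosed n lam G ->
  (Fminus lam G).[z] = 0 ->
  exists2 H, Fminus lam G = ('X - z%:P) * H & H.[z] != 0.
Proof.
move=> lam0 hT; rewrite horner_Fminus => /eqP/factor_theorem [Q]; rewrite mulrC => e.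
set k := expi (- (lam / 2)) in e *.
exists (k *: (Q \Po (k *: 'X))); last first.
  rewrite hornerZ horner_comp hornerZ hornerX mulf_neq0 ?expi_neq0 //.
  exact: Tclosed_simple lam0 hT e.
rewrite /Fminus -/k {1}e comp_polyM comp_polyB comp_polyX comp_polyC.
by rewrite -scalerAr scalerAl scalerBr -!mul_polyC -polyCM.
Qed.

(** Where the quotient of [F] is real on the circle, the Wronskian vanishes to
    second order, because the imaginary part attains its minimum [0] there.
    Written in terms of the combination, this says that its quotient, once a
    possible common zero is cancelled, agrees at [z0] with the quotient of
    [ninv n F], whose value is the conjugate of the real number [x]. *)
Lemma quot_limit n lam F s zeta z0 (x : R) : 0 < lam ->
  zeros_of F s -> size F = n.+1 -> all in_disk s ->
  (forall t, total_phase s (t + lam) - total_phase s t <= pi) -> lam < 2 * pi ->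
  Tclosed n lam (F + zeta *: ninv n F) -> `|z0| = 1 -> quot n lam F z0 = x%:C ->
  (fun z : R[i]^o => quot n lam (F + zeta *: ninv n F) z : R[i]^o)
    @ (z0 : R[i]^o)^' --> (x%:C : R[i]^o).
Proof.
move=> lam0 h sF sD step lam2 hT z1 hx; have [u0 _ ez] := unit_expi z1.
have F0 : F != 0 by rewrite -size_poly_gt0 sF.
have circ0 v : F.[expi v] != 0 by apply: in_disk_no_circle_root h sD (norm_expi v).
have nonneg u : 0 <= complex.Im (quot n lam F (expi u)).
  have [|m m0 e] := @quot_total_phase R n lam F s 1 u h sF ltr01.
    by rewrite map_divr1.
  rewrite mul1r map_divr1 in e; rewrite e Im_scale pmulr_rge0 //=.
  apply: sin_ge0_pi; apply/andP; split.
    rewrite subr_ge0; apply: le_total_phase => //; clear z1; lra.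
  rewrite (_ : u + lam / 2 = u - lam / 2 + lam); first exact: step.
  by clear z1; lra.
set G := F + _ in hT *; set N := ninv n F.
pose k u := 2 * complex.Re (`|(Fminus lam F).[expi u]| ^+ 2) * complex.Im (quot n lam F (expi u)).
have Fm0 u : (Fminus lam F).[expi u] != 0 by rewrite horner_Fminus -expiD.
have hW u := quot_wronskian_circle sF (Fm0 u).
have k0 u : 0 <= k u.
  rewrite /k !mulr_ge0 //; have := exprn_ge0 2 (normr_ge0 (Fminus lam F).[expi u]).
  by rewrite lecE /= => /andP[].
have W0 : (quot_wronskian n lam F).[z0] = 0 by rewrite ez hW -ez hx /= mulr0 mulr0.
have WG := quot_wronskian_combination n lam F zeta; rewrite /= -/G -/N in WG.
have Nc v : N.[expi v] = expi v ^+ n * conjc F.[expi v].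
  by rewrite horner_ninv_circle ?sF ?norm_expi.
have Nm0 : (Fminus lam N).[z0] != 0.
  by rewrite ez horner_Fminus -expiD Nc mulf_neq0 ?expf_neq0 ?expi_neq0 // conjc_eq0.
pose e := expi (- (n%:R * lam / 2)).
(* The quotient of [ninv n F] also takes the value [x]. *)
have ratio : x%:C = e * ((Fplus lam N).[z0] / (Fminus lam N).[z0]).
  have Wz : (Fplus lam F).[z0] * (Fminus lam N).[z0] = (Fminus lam F).[z0] * (Fplus lam N).[z0].
    move: W0; rewrite /quot_wronskian hornerD hornerN !hornerM -/N => /eqP.
    by rewrite subr_eq0 => /eqP.
  have Fmz : (Fminus lam F).[z0] != 0 by rewrite ez.
  rewrite -hx /quot; congr (_ * _); apply/eqP.
  by rewrite eqr_div // Wz mulrC.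
suff [P [Q [Q0 PQ hq]]] : exists P Q, [/\ Q.[z0] != 0,
    P.[z0] * (Fminus lam N).[z0] = Q.[z0] * (Fplus lam N).[z0] &
    forall w, w != z0 -> quot n lam G w = e * (P.[w] / Q.[w])].
  rewrite ratio; have -> : (Fplus lam N).[z0] / (Fminus lam N).[z0] = P.[z0] / Q.[z0].
    by apply/eqP; rewrite eqr_div // mulrC -PQ.
  exact: cvg_ratio.
have WGz : (Fplus lam G).[z0] * (Fminus lam N).[z0] = (Fminus lam G).[z0] * (Fplus lam N).[z0].
  by move: W0; rewrite WG hornerD hornerN !hornerM => /eqP; rewrite subr_eq0 => /eqP.
have [Gm0|Gm0] := eqVneq (Fminus lam G).[z0] 0; last first.
  by exists (Fplus lam G), (Fminus lam G).
have [Q eQ Q0] := Fminus_simple_root lam0 hT Gm0.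
have /factor_theorem [P] : root (Fplus lam G) z0.
  by apply/rootP/eqP; move/eqP: WGz; rewrite Gm0 mul0r mulf_eq0 (negbTE Nm0) orbF.
rewrite mulrC => eP.
have eW : quot_wronskian n lam F =
    ('X - (expi u0)%:P) * (P * Fminus lam N - Q * Fplus lam N).
  by rewrite WG eP eQ -ez mulrBr !mulrA.
have := nonneg_circle_double_root k0 hW eW; rewrite -ez.
rewrite hornerD hornerN !hornerM => /eqP; rewrite subr_eq0 => /eqP PQ.
exists P, Q; split => // w wz.
rewrite /quot eP eQ !hornerM hornerXsubC -mulf_div divff ?mul1r //.
by rewrite subr_eq0.
Qed.

Lemma in_disk_not_circle n F s : (0 < n)%N -> size F = n.+1 ->
  zeros_of F s -> all in_disk s -> ~ polys_in n (@unit_circle R) F.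
Proof.
move=> n0 sF h sD [_ hF]; have F0 : F != 0 by rewrite -size_poly_gt0 sF.
have : size s = n by have := size_zeros F0 h; rewrite sF => -[].
case: s h sD => [_ _ n00|a s h /= /andP[aD _] _]; first by move: n0; rewrite -n00.
have : root F a by rewrite -[root F a]/(a \in root F) (root_zeros F0 h) mem_head.
by move=> /hF; rewrite /unit_circle /= => a1; move: aD; rewrite /in_disk a1 ltxx.
Qed.

Lemma Topen_Tclosed n lam P : Topen n lam P -> Tclosed n lam P.
Proof.
by move=> [hP [s hs sep]]; split => //; exists s => //; apply: sub_pairwise sep => a b /ltW.
Qed.

Lemma Dopen_step n lam F s : (0 < n)%N -> 0 < lam < 2 * pi / n%:R ->
  polys_in n (@closed_disk R) F -> zeros_of F s ->
  (forall z, ~ `|z| < 1 -> 0 < complex.Im (quot n lam F z)) ->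
  all in_disk s /\ forall t, total_phase s (t + lam) - total_phase s t < pi.
Proof.
move=> n0 hlam [sF hF] h hD; have F0 : F != 0 by rewrite -size_poly_gt0 sF.
have sn : size s = n by have := size_zeros F0 h; rewrite sF => -[].
have sD : all in_disk s.
  apply/allP => a; rewrite -(root_zeros F0 h) => ra.
  have := hF _ ra; rewrite /closed_disk /in_disk /= le_eqVlt => /predU1P[a1|//].
  have := hD (expi (lam / 2) * a); rewrite normrM norm_expi a1 mulr1 ltxx => /(_ notF).
  rewrite /quot horner_Fminus mulrA -expiD addNr expi0 mul1r (rootP ra) invr0 !mulr0.
  by rewrite /= ltxx.
have hsin t : 0 < sin (total_phase s (t + lam) - total_phase s t).
  have := @Im_quot_sin R n lam F s 1 t h sF ltr01; rewrite /= map_divr1 mul1r.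
  by move=> /(_ sD) <-; apply: hD; rewrite norm_expi ltxx.
split=> // t; rewrite lt_neqAle total_phase_step_le_pi ?sn //.
- by rewrite andbT; apply/eqP => e; have := hsin t; rewrite e sinpi ltxx.
- by rewrite -size_eq0 sn -lt0n.
- by move=> v; exact/ltW.
Qed.

(** If a step gained [pi] or more, the combination vanishing at its start
    would have a second zero within the step. *)
Lemma combinations_Topen_step n lam F s : (0 < n)%N -> 0 < lam -> lam < 2 * pi ->
  size F = n.+1 -> zeros_of F s -> all in_disk s ->
  (forall zeta, `|zeta| = 1 -> Topen n lam (F + zeta *: ninv n F)) ->
  forall t, total_phase s (t + lam) - total_phase s t < pi.
Proof.
move=> n0 lam0 lam2 sF h sD hT t; rewrite ltNge; apply/negP => hpi.
have F0 : F != 0 by rewrite -size_poly_gt0 sF.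
have l0 : lead_coef F != 0 by rewrite lead_coef_eq0.
have sn : size s = n by have := size_zeros F0 h; rewrite sF => -[].
have s0 : s != [::] by rewrite -size_eq0 sn -lt0n.
have [t' ht'] := total_phase_surj (total_phase s t + pi) sD s0.
have p0 := pi_gt0 R.
have tt' : t < t' by rewrite ltNge; apply/negP => /(le_total_phase sD); lra.
have t't : t' <= t + lam by rewrite leNgt; apply/negP => /(lt_total_phase sD s0); lra.
pose zeta := - (lead_coef F * expi (2 * total_phase s t)) / conjc (lead_coef F).
have hz : zeta * conjc (lead_coef F) = - (lead_coef F * expi (2 * total_phase s t)).
  by rewrite /zeta divfK // conjc_eq0.
have z1 : `|zeta| = 1.
  by rewrite /zeta normrM normrN normrM norm_expi mulr1 normfV normcJ divff // normr_eq0.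
have [[sG hG] [l hl sep]] := hT _ z1.
have G0 : F + zeta *: ninv n F != 0 by rewrite -size_poly_gt0 sG.
have r1 : expi t \in l.
  by rewrite -(root_zeros G0 hl) /= -topredE /= (root_combination t h sF sD hz) subrr sin0.
have r2 : expi t' \in l.
  rewrite -(root_zeros G0 hl) /= -topredE /= (root_combination t' h sF sD hz) ht'.
  by rewrite addrAC subrr add0r sinpi.
clear z1.
have nq : expi t' != expi t by apply: expi_neq; rewrite gtr0_norm; lra.
have pl := perm_to_rem r1.
have := perm_pairwise (fun x y => congr1 (fun d => lam < d) (angleC _ _)) pl sep.
move: r2; rewrite (perm_mem pl) inE (negbTE nq) /= => r2 /andP[/allP/(_ _ r2) ang _].
have := angle_le_pi (norm_expi t) (norm_expi t') => api.
have lampi := lt_le_trans ang api.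
move: ang; rewrite angle_expi_min gtr0_norm; [|lra..].
by rewrite lt_min; lra.
Qed.

Lemma step_Dopen n lam F s : (0 < n)%N -> zeros_of F s -> Dclosed n lam F ->
  all in_disk s -> 0 < lam ->
  (forall t, total_phase s (t + lam) - total_phase s t < pi) -> Dopen n lam F.
Proof.
move=> n0 h [sF hD] sD lam0 step; right; split => // z hz.
have F0 : F != 0 by rewrite -size_poly_gt0 sF.
have s0 : s != [::].
  by apply: contraTneq n0 => s0; have := size_zeros F0 h; rewrite sF s0 => -[->].
have [zo|zo] := pselect (closed_disk z); last exact: hD.
have z1 : `|z| = 1 by apply/eqP; move: zo hz; rewrite /closed_disk /= le_eqVlt => /predU1P[->|].
have [u _ ->] := unit_expi z1; clear zo hz z1.
have := @Im_quot_sin R n lam F s 1 (u - lam / 2) h sF ltr01.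
rewrite /= map_divr1 mul1r subrK => -> //.
apply: sin_gt0_pi; rewrite step andbT subr_gt0; apply: lt_total_phase => //.
by rewrite ltrDl.
Qed.

End MainLemmas.

Theorem theorem9 (R : realType) (n : nat) (lam : R) (F : {poly R[i]})
    (hn : (0 < n)%N) (hlam : 0 < lam < 2 * pi / n%:R)
    (hF : polys_in n (@closed_disk R) F) :
  [/\ (Dclosed n lam `\` Tclosed n lam) F <->
        (forall zeta : R[i], `|zeta| = 1 ->
           Tclosed n lam (F + zeta *: ninv n F)),
      (Dopen n lam `\` Topen n lam) F <->
        (forall zeta : R[i], `|zeta| = 1 ->
           Topen n lam (F + zeta *: ninv n F))
    & (Dclosed n lam `\` Tclosed n lam) F ->
      forall (z0 : R[i]) (x : R), `|z0| = 1 ->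
        (Fminus lam F).[z0] != 0 -> quot n lam F z0 = x%:C ->
        forall zeta : R[i], `|zeta| = 1 ->
          ((fun z : R[i]^o => quot n lam (F + zeta *: ninv n F) z : R[i]^o)
             @ (z0 : R[i]^o)^' --> (x%:C : R[i]^o))].
Proof.
have [s h] := zeros_exist F; have [sF _] := hF.
have lam0 : 0 < lam by case/andP: hlam.
have lam2 := step_lt_2pi hn hlam.
have closed_in_disk := combinations_in_disk lam0 hF.
have circ sD := in_disk_not_circle hn sF h sD.
have closedP : (Dclosed n lam `\` Tclosed n lam) F <->
    (forall zeta : R[i], `|zeta| = 1 -> Tclosed n lam (F + zeta *: ninv n F)).
  split=> [hD zeta z1|hT].
    have [sD step] := Dclosed_not_Tclosed hn hlam hF h hD.
    exact: step_Tclosed h sF sD z1 step.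
  split; first exact: combinations_Dclosed.
  by case=> /(circ (closed_in_disk _ hT h)).
split=> //.
  split=> [[hD nT] zeta z1|hT].
    case: hD => [//|[_ hD]]; have [sD step] := Dopen_step hn hlam hF h hD.
    exact: step_Topen h sF sD z1 step.
  have hTc zeta (z1 : `|zeta| = 1) := Topen_Tclosed (hT zeta z1).
  have sD := closed_in_disk _ hTc h.
  have step := combinations_Topen_step hn lam0 lam2 sF h sD hT.
  split; last by case=> /(circ sD).
  apply: (step_Dopen hn h _ sD lam0 step).
  exact: combinations_Dclosed hn hlam hF hTc.
move=> hD z0 x z1 _ hx zeta zeta1.
have [sD step] := Dclosed_not_Tclosed hn hlam hF h hD.
exact: quot_limit lam0 h sF sD step lam2 (closedP.1 hD _ zeta1) z1 hx.
Qed.
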